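(* (Down-up horizontal $\imath$Pieri rule.) For every integer $r\ge 1$ and every partition $\mu$, the following identity holds in $\Lambda_{t,\theta}$: $$V^{\imath}_\mu\cdot v_r=\sum_{a+b=r}\ \sum_{\nu\stackrel{a}{\rightarrow}\mu,\ \nu\stackrel{b}{\rightarrow}\lambda}\theta^{a}\,\varphi_{\mu/\nu}(t)\,\psi_{\lambda/\nu}(t)\;V^{\imath}_\lambda ,$$ where $a,b$ run over non-negative integers with $a+b=r$, and the inner sum is over all pairs of partitions $(\nu,\lambda)$ with $\nu\stackrel{a}{\rightarrow}\mu$ and $\nu\stackrel{b}{\rightarrow}\lambda$.
   Context: Let $t,\theta$ be indeterminates and $\Lambda_{t,\theta}=\mathbb{Q}(t)[\theta][v_1,v_2,\ldots]$ the polynomial ring in commuting variables $v_r$ ($r\ge1$). Set $v_0=1$, $v_a=0$ for $a<0$, and $v_\alpha=v_{\alpha_1}v_{\alpha_2}\cdots$ for an integer sequence $\alpha=(\alpha_1,\alpha_2,\ldots)$ with finitely many nonzero entries. For $1\le i<j$ the raising operator $R_{ij}$ sends $\alpha$ to $(\ldots,\alpha_i+1,\ldots,\alpha_j-1,\ldots)$ and the lowering operator $L_{ij}$ sends $\alpha$ to $(\ldots,\alpha_i-1,\ldots,\alpha_j-1,\ldots)$; they act by $R_{ij}v_\alpha=v_{R_{ij}\alpha}$, $L_{ij}v_\alpha=v_{L_{ij}\alpha}$ (products of operators are applied to the index sequence first, and only then is $v$ evaluated; all these operators commute). For an integer vector $\alpha$ define $$V^{\imath}_\alpha=\prod_{1\le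 i<j}\frac{1-\theta L_{ij}}{1-\theta tL_{ij}}\,\frac{1-R_{ij}}{1-tR_{ij}}\;v_\alpha,$$ where $\frac{1-u}{1-tu}$ is expanded as $1+(1-t^{-1})\sum_{s\ge1}t^su^s$; only finitely many terms are nonzero. For partitions, $\nu\le\mu$ means $\nu_i\le\mu_i$ for all $i$; $\nu\stackrel{a}{\rightarrow}\mu$ means $\nu\le\mu$ and $\mu-\nu$ is a horizontal $a$-strip ($a$ boxes, at most one in each column). $\mu'$ denotes the conjugate partition and $m_i(\mu)$ the number of parts of $\mu$ equal to $i$. For a horizontal strip $\sigma=\lambda-\nu$ put $\sigma_i'=\lambda_i'-\nu_i'\in\{0,1\}$; let $I_{\lambda-\nu}$ be the set of $i\ge1$ with $\sigma_i'=1,\ \sigma_{i+1}'=0$, and $J_{\lambda-\nu}$ the set of $i\ge 1$ with $\sigma_i'=0,\ \sigma'_{i+1}=1$. Define $$\varphi_{\lambda/\nu}(t)=\prod_{i\in I_{\lambda-\nu}}(1-t^{m_i(\lambda)}),\qquad \psi_{\lambda/\nu}(t)=\prod_{j\in J_{\lambda-\nu}}(1-t^{m_j(\nu)}).$$ *)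

(* Defs.v *)
From HB Require Import structures.
From mathcomp Require Import all_boot all_order all_algebra.
From mathcomp Require Import finmap monalg.
From mathcomp Require Import classical_sets fsbigop.

Set Implicit Arguments.
Unset Strict Implicit.
Unset Printing Implicit Defensive.

Import Order.TTheory GRing.Theory Num.Theory.

Local Open Scope classical_set_scope.
Local Open Scope ring_scope.

(* Q(t) *)
Definition Qt : fieldType := {fraction {poly rat}}.
Definition t : Qt := tofrac 'X.

(* Q(t)[theta] *)
Definition Qtth : comNzRingType := {poly Qt}.
Definition theta : Qtth := 'X.

(* The polynomial ring over Q(t)[theta] in the variables v_1, v_2, ..., as the
   monoid algebra of the free commutative monoid on nat; the variable with
   index k : nat stands for v_(k+1). *)
Definition Lam : comAlgType Qtth := {malg Qtth[{cmonom nat}]}.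

Definition v (n : int) : Lam :=
  match n with
  | Posz 0 => 1
  | Posz k.+1 => << ucm k >>
  | Negz _ => 0
  end.

(* Integer sequences with finitely many nonzero entries; the entry alpha_i
   (i >= 1) is found at index i - 1. *)
Definition intvec : choiceType := {fsfun nat -> int with 0%R}.

Definition vseq (alpha : intvec) : Lam :=
  \prod_(i <- finsupp alpha) v (alpha i).

Definition raising (p : nat * nat) (alpha : intvec) : intvec :=
  [fsfun alpha with p.1 |-> alpha p.1 + 1, p.2 |-> alpha p.2 - 1].

Definition lowering (p : nat * nat) (alpha : intvec) : intvec :=
  [fsfun alpha with p.1 |-> alpha p.1 - 1, p.2 |-> alpha p.2 - 1].

(* Exponents of a monomial in operators indexed by pairs. *)
Definition opexp : choiceType := {fsfun nat * nat -> nat with 0%N}.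

(* prod_p (op p)^(e p), applied to alpha; the order of the factors is
   irrelevant since the operators above commute. *)
Definition opmonom (op : nat * nat -> intvec -> intvec) (e : opexp)
    (alpha : intvec) : intvec :=
  foldr (fun p beta => iter (e p) (op p) beta) alpha (finsupp e).

Definition on_increasing_pairs (e : opexp) : Prop :=
  forall p : nat * nat, p \in finsupp e -> (p.1 < p.2)%N.

(* coefficient of u^s in (1 - u) / (1 - t u) *)
Definition ratio_coef (s : nat) : Qt :=
  if s is 0 then 1 else (1 - t^-1) * t ^+ s.

(* V^imath: the product of all the series is expanded as a sum over pairs
   (l, m) of exponents, l for the L_ij and m for the R_ij.  Only finitely many
   terms are nonzero, which is what the sum operator requires. *)
Definition Vi (alpha : intvec) : Lam :=
  \sum_(lm \in [set lm : opexp * opexp |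
                  on_increasing_pairs lm.1 /\ on_increasing_pairs lm.2])
    ((\prod_(p <- finsupp lm.1)
         ((ratio_coef (lm.1 p))%:P * theta ^+ lm.1 p : Qtth)) *
     (\prod_(p <- finsupp lm.2) (ratio_coef (lm.2 p))%:P))
    *: vseq (opmonom lowering lm.1 (opmonom raising lm.2 alpha)).

Definition is_partition (s : seq nat) : bool :=
  sorted geq s && (0%N \notin s).

Record intpart := IntPart {
  parts :> seq nat;
  _ : is_partition parts
}.
HB.instance Definition _ := [isSub for parts].
HB.instance Definition _ := [Choice of intpart by <:].

Definition intvec_of_partition (lam : intpart) : intvec :=
  [fsfun i in [fset i | i in iota 0 (size lam)]%fset => (nth 0 lam i)%:Z].

(* lam'_i, for i >= 1 *)
Definition conj_part (lam : intpart) (i : nat) : nat :=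
  count (fun x => i <= x)%N lam.

(* m_i(lam) *)
Definition mult (i : nat) (lam : intpart) : nat := count_mem i lam.

Definition part_le (nu mu : intpart) : Prop :=
  forall i : nat, (nth 0 nu i <= nth 0 mu i)%N.

(* sigma'_i = mu'_i - nu'_i, the number of boxes of sigma = mu - nu in
   column i *)
Definition column_size (nu mu : intpart) (i : nat) : nat :=
  (conj_part mu i - conj_part nu i)%N.

(* nu --a--> mu *)
Definition hstrip (a : nat) (nu mu : intpart) : Prop :=
  [/\ part_le nu mu,
      sumn mu = (sumn nu + a)%N
    & forall i : nat, (0 < i)%N -> (column_size nu mu i <= 1)%N].

Definition Iset (lam nu : intpart) : set nat :=
  [set i | [/\ (0 < i)%N, column_size nu lam i = 1%N
             & column_size nu lam i.+1 = 0%N]].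

Definition Jset (lam nu : intpart) : set nat :=
  [set i | [/\ (0 < i)%N, column_size nu lam i = 0%N
             & column_size nu lam i.+1 = 1%N]].

(* Iset and Jset are finite: all their elements are at most lam_1. *)
Definition phi (lam nu : intpart) : Qt :=
  \big[*%R/1]_(i \in Iset lam nu) (1 - t ^+ mult i lam).

Definition psi (lam nu : intpart) : Qt :=
  \big[*%R/1]_(j \in Jset lam nu) (1 - t ^+ mult j nu).

(* Main.v *)
(* Put c(0) = 1 and c(s) = 1 - t for s > 0, the coefficients of
   (1 - t x) / (1 - x).  Dividing the generating function V(z, u) of the
   V_alpha by its factors that involve both u and one of the z_i leaves
   V(z) v(u).  Hence

     V_mu v_r = sum_s theta^|s| prod_i c(s_i) W(mu - s, r - |s|),
     W(nu, b) = sum_p prod_i c(p_i) V(nu + p, b - |p|),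

   where W is obtained from V_nu v_b by the factors with lowering operators
   L_(i,n+1) only.  Both V and W straighten: at two adjacent rows

     sum_(1 <= u <= d) c(d - u) f(m - u, m - d + u) = t f(m, m - d),

   because their generating function is (x - y) / (x - t y) times a symmetric
   function of the two variables.  Applied from the first row to the last,
   this relation collapses the first sum to the horizontal strips mu - nu with
   weight phi; applied from the last row to the first, it collapses the second
   sum to the horizontal strips lambda - nu with weight psi. *)
Require Import Defs.
From mathcomp Require Import all_boot all_order all_algebra.
From mathcomp Require Import finmap monalg.
From mathcomp Require Import boolp classical_sets fsbigop.
From mathcomp Require Import zify ring.

Set Implicit Arguments.
Unset Strict Implicit.
Unset Printing Implicit Defensive.

Import Order.TTheory GRing.Theory Num.Theory.

Local Open Scope classical_set_scope.
Local Open Scope ring_scope.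

(** * Collapsing sums over rows to strips *)

(** Both collapses are instances of [strip_sum] and differ in the initial state. In the first sum
    every row carries c, so the state starts at t; the last row r - |s| takes no part, since W lacks
    the factors R_(i,n+1) and has no straightening relation there. In the second sum the boxes left
    over go to the new row n + 1 with coefficient 1, which is c with t replaced by 0. So the state
    starts at 0, and this is why psi has no factor for the zero parts of nu. Removing more boxes
    from a row than its distance k to the next one breaks interlacing. For a fixed total removed
    from the two rows, all such terms straighten onto the term with s = k and change only its
    coefficient. The change can be absorbed into the coefficients of the next row, which keep the
    form 1, 1 - x, 1 - x, ...; this is what makes an induction on rows possible. *)

Fixpoint exponents (N k : nat) : seq (seq nat) :=
  if k is k'.+1 then [seq s :: e | s <- iota 0 N, e <- exponents N k'] else [:: [::]].

Lemma mem_exponents N k e : (e \in exponents N k) = (size e == k) && all (ltn^~ N) e.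
Proof.
elim: k e => [|k IHk] [|s e] //=.
  by apply/negP => /allpairsP[[u w] []].
rewrite eqSS; apply/allpairsP/andP => [[[u w] /= [+ wN [-> ->]]]|[/eqP sk /andP[sN eN]]].
  by rewrite mem_iota; move: wN; rewrite IHk => /andP[-> ->] /= ->.
by exists (s, e); rewrite mem_iota IHk sk eqxx.
Qed.

Lemma exponents_uniq N k : uniq (exponents N k).
Proof.
by elim: k => //= k IHk; apply: allpairs_uniq; rewrite ?iota_uniq // => -[a b] [c d] _ _ /= [-> ->].
Qed.

Lemma big_exponents0 (M : nmodType) N P (F : seq nat -> M) :
  \sum_(e <- exponents N 0 | P e) F e = if P [::] then F [::] else 0.
Proof. by rewrite /= big_cons big_nil; case: ifP; rewrite ?addr0. Qed.

Lemma big_exponentsS (M : nmodType) N k P (F : seq nat -> M) :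
  \sum_(e <- exponents N k.+1 | P e) F e =
  \sum_(0 <= s < N) \sum_(e <- exponents N k | P (s :: e)) F (s :: e).
Proof.
rewrite big_mkcond /= big_allpairs_dep /= /index_iota subn0.
by apply: eq_bigr => s _; rewrite -big_mkcond.
Qed.

Arguments exponents : simpl never.

(** Straightening relations and products of series are homogeneous in a + b, so the truncated square
    is regrouped by the total d. *)
Lemma big_triangle (M : nmodType) N (h : nat -> nat -> M) :
  (forall a b, (N <= a + b)%N -> h a b = 0) ->
  \sum_(0 <= a < N) \sum_(0 <= b < N) h a b =
  \sum_(0 <= d < N) \sum_(0 <= a < d.+1) h a (d - a)%N.
Proof.
move=> h0.
transitivity (\sum_(0 <= a < N) \sum_(0 <= d < N | (a <= d)%N) h a (d - a)%N).
  apply: eq_big_nat => a /= aN.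
  rewrite [RHS]big_mkcond /= [RHS](@big_cat_nat _ _ _ a) /=; [|lia|lia].
  rewrite [X in _ = X + _]big1_seq ?add0r; last by move=> i; rewrite mem_index_iota => ?; case: ifP => //; lia.
  have := big_addn 0 N a xpredT (fun d => if (a <= d)%N then h a (d - a)%N else 0).
  rewrite add0n => ->.
  rewrite (@big_cat_nat _ _ _ (N - a)) //=; last lia.
  rewrite [X in _ + X = _]big1_seq ?addr0.
    by apply: eq_big_nat => i _; rewrite leq_addl addnK.
  by move=> i; rewrite mem_index_iota => ?; apply: h0; lia.
rewrite (exchange_big_dep_nat xpredT) //=; apply: eq_big_nat => d dN.
rewrite big_mkcond (@big_cat_nat _ _ _ d.+1) //=.
rewrite [X in _ + X = _]big1_seq ?addr0.
  by apply: eq_big_nat => i ?; case: ifP => //; lia.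
by move=> i; rewrite mem_index_iota => ?; case: ifP => //; lia.
Qed.

Section Strip.
Variables (K : comNzRingType) (M : lmodType K) (t : K).
Implicit Types (x : K) (e : seq nat) (mu : seq int).

(* the coefficients of (1 - x u) / (1 - u) *)
Definition strip_coef x s : K := if s is 0 then 1 else 1 - x.

(* Rows are processed from the first to the last, the current one carrying the
   coefficients [strip_coef x].  Here [x] is t to the number of equal rows met
   so far, or 0 when the row above has come down to the current one; [k] is the
   distance to the next row and [s] the number of boxes removed. *)
Definition next_state x k s : K := if k == 0%N then x * t else if s == k then 0 else t.

Fixpoint free_weight x e : K := if e is s :: e' then strip_coef x s * free_weight t e' else 1.

Definition lowered mu e : seq int := [seq p.1 - p.2%:Z | p <- zip mu e].

(** The interlacing condition: a row may come down to the original next row but not below it. The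
    last row is free; appending an entry 0 to [mu] bounds it as well. *)
Fixpoint fits mu e : bool :=
  match mu, e with
  | m1 :: (m2 :: _) as mu', s :: e' => (s%:Z <= m1 - m2) && fits mu' e'
  | _, _ => true
  end.

Fixpoint strip_weight x mu e : K :=
  match mu, e with
  | m1 :: mu', s :: e' =>
      strip_coef x s * strip_weight (next_state x `|m1 - head m1 mu'|%N s) mu' e'
  | _, _ => 1
  end.

(* the second argument of [f] is a mere parameter: the number of boxes removed *)
Definition straightens n (f : seq int -> nat -> M) :=
  forall a l1 l2 (m : int) (d : nat),
    (size l1 + size l2).+2 = n -> (0 < d)%N ->
    \sum_(1 <= u < d.+1)
      strip_coef t (d - u) *: f (l1 ++ (m - u%:Z) :: (m - (d - u)%:Z) :: l2) a =
    t *: f (l1 ++ m :: (m - d%:Z) :: l2) a.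

(* The terms with [s > k] straighten onto those with [s = k], where the first
   row meets the second one. *)
Lemma two_rows N x (m : int) k (g : int -> int -> nat -> M) :
  (forall b c d, (N <= d)%N -> g b c d = 0) ->
  (forall a d, (0 < d)%N ->
     \sum_(1 <= u < d.+1) strip_coef t (d - u) *: g (m - u%:Z) (m - (d - u)%:Z) a =
     t *: g m (m - d%:Z) a) ->
  \sum_(0 <= s < N) \sum_(0 <= s' < N)
     (strip_coef x s * strip_coef t s') *: g (m + k%:Z - s%:Z) (m - s'%:Z) (s + s')%N =
  \sum_(0 <= s < N | (s <= k)%N) strip_coef x s *: \sum_(0 <= s' < N)
     strip_coef (next_state x k s) s' *: g (m + k%:Z - s%:Z) (m - s'%:Z) (s + s')%N.
Proof.
move=> g0 gE.
rewrite big_triangle; last by move=> a b Nab; rewrite g0 ?scaler0.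
under [RHS]eq_bigr do rewrite scaler_sumr.
rewrite [RHS]big_mkcond /=.
under [RHS]eq_bigr => s _.
  rewrite (_ : (if _ then _ else _) = \sum_(0 <= s' < N)
    (if (s <= k)%N then (strip_coef x s * strip_coef (next_state x k s) s') *: g (m + k%:Z - s%:Z) (m - s'%:Z) (s + s')%N
     else 0)); last first.
    by case: ifP => _; [apply: eq_bigr => s' _; rewrite scalerA | rewrite big1].
  over.
rewrite /= big_triangle; last by move=> a b Nab; rewrite g0 ?scaler0 // if_same.
apply: eq_big_nat => d _.
have [dk|kd] := leqP d k.
  apply: eq_big_nat => s /andP[_ sd]; rewrite (_ : (s <= k)%N); last lia.
  congr (_ *: _); congr (_ * _); rewrite /next_state.
  have [/eqP k0|k0] := boolP (k == 0%N); first by rewrite (_ : (d - s = 0)%N) //; lia.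
  have [/eqP sk|//] := boolP (s == k); by rewrite (_ : (d - s = 0)%N) //; lia.
rewrite [LHS](@big_cat_nat _ _ _ k.+1) //=; last lia.
rewrite [RHS](@big_cat_nat _ _ _ k.+1) //=; last lia.
rewrite [X in _ = _ + X]big1_seq ?addr0; last first.
  by move=> s; rewrite mem_index_iota => ?; case: ifP => //; lia.
rewrite [X in X + _](@big_nat_recr _ _ _ k) //= [RHS](@big_nat_recr _ _ _ k) //=.
rewrite -addrA; congr (_ + _).
  apply: eq_big_nat => s sk; rewrite ifT; last lia.
  by rewrite /next_state !ifF //; apply/eqP; lia.
rewrite leqnn addrK subnKC; last lia.
(* The tail s > k is a straightening relation with u = s - k and total d - k; its coefficients
   [strip_coef x s] all equal 1 - x because s > 0. *)
have -> : \sum_(k.+1 <= s < d.+1)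
    (strip_coef x s * strip_coef t (d - s)) *: g (m + k%:Z - s%:Z) (m - (d - s)%:Z) (s + (d - s))%N =
  ((1 - x) * t) *: g m (m - (d - k)%:Z) d.
  rewrite -scalerA -gE; last lia.
  rewrite (_ : k.+1 = 1 + k)%N // big_addn scaler_sumr.
  rewrite (_ : d.+1 - k = (d - k).+1)%N; last lia.
  apply: eq_big_nat => u u1; rewrite scalerA.
  rewrite (_ : u + k + (d - (u + k)) = d)%N; last lia.
  rewrite (_ : d - (u + k) = d - k - u)%N; last lia.
  rewrite (_ : m + k%:Z - (u + k)%:Z = m - u%:Z); last lia.
  by case: u u1.
(* For k > 0, (1 - x)(1 - t) + (1 - x) t = 1 - x leaves the second row the coefficient 1, hence
   state 0. For k = 0, (1 - t) + (1 - x) t = 1 - x t gives state x t. *)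
rewrite -scalerDl; congr (_ *: _).
rewrite /next_state eqxx; case: (d - k)%N (subn_gt0 k d) => [|d' _]; first by rewrite kd.
by case: (k) => [|k'] /=; ring.
Qed.

(** Induction on the rows with [x] and [f] general: [two_rows] bounds the first row and records its
    effect in the state of the second, after which the first row is frozen inside [f]. *)
Lemma strip_sum N x mu (f : seq int -> nat -> M) :
  sorted >=%R mu -> straightens (size mu) f ->
  (forall l a, (N <= a)%N -> f l a = 0) ->
  \sum_(e <- exponents N (size mu)) free_weight x e *: f (lowered mu e) (sumn e) =
  \sum_(e <- exponents N (size mu) | fits mu e) strip_weight x mu e *: f (lowered mu e) (sumn e).
Proof.
elim: mu x f => [|m1 [|m2 mu] IH] x f.
- by move=> _ _ _; rewrite !big_exponents0.
- by move=> _ _ _; rewrite !big_exponentsS; apply: eq_bigr => s _; rewrite !big_exponents0 /= mulr1.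
move=> /= /andP[m21 smu] fE f0.
have [k Ek] : exists k : nat, m1 = m2 + k%:Z by exists `|m1 - m2|%N; lia.
rewrite !big_exponentsS.
(* Summing over the later rows leaves a function of two rows that inherits the relation of [f]. *)
pose g b c d := \sum_(e <- exponents N (size mu)) free_weight t e *: f (b :: c :: lowered mu e) (d + sumn e)%N.
transitivity (\sum_(0 <= s < N) \sum_(0 <= s' < N)
     (strip_coef x s * strip_coef t s') *: g (m2 + k%:Z - s%:Z) (m2 - s'%:Z) (s + s')%N).
  apply: eq_bigr => s _; rewrite big_exponentsS; apply: eq_bigr => s' _.
  rewrite scaler_sumr; apply: eq_bigr => e _.
  by rewrite /= scalerA mulrA addnA Ek.
rewrite two_rows; first last.
- move=> a d d0; rewrite /g scaler_sumr.
  under eq_bigr do rewrite scaler_sumr.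
  rewrite exchange_big /=; rewrite big_seq [RHS]big_seq; apply: eq_bigr => e.
  rewrite mem_exponents => /andP[/eqP se _].
  under eq_bigr do rewrite scalerA mulrC -scalerA.
  rewrite -scaler_sumr scalerA mulrC -scalerA; congr (_ *: _).
  apply: (fE _ [::]) => //=; by rewrite size_map size_zip se minnn.
- by move=> b c d Nd; rewrite /g big1_seq // => e _; rewrite f0 ?scaler0 //; lia.
rewrite big_mkcond; apply: eq_bigr => s _.
rewrite (_ : (s%:Z <= m1 - m2) = (s <= k)%N); last by rewrite Ek; lia.
case: ifP => sk; last by rewrite big_pred0.
transitivity (strip_coef x s *: \sum_(e <- exponents N (size mu).+1) free_weight (next_state x k s) e *: f ((m1 - s%:Z) :: lowered (m2 :: mu) e) (s + sumn e)%N).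
  congr (_ *: _); rewrite big_exponentsS; apply: eq_bigr => s' _; rewrite /g scaler_sumr.
  by apply: eq_bigr => e _; rewrite /= scalerA addnA Ek.
rewrite (IH _ (fun l a => f (m1 - s%:Z :: l) (s + a)%N)) //.
- rewrite scaler_sumr; apply: eq_bigr => e _; rewrite scalerA.
  by rewrite (_ : `|m1 - m2|%N = k) //; lia.
- move=> a l1 l2 m d sl d0; apply: (fE _ (_ :: l1)) => //; move: sl => /=; lia.
- by move=> l a Na; apply: f0; lia.
Qed.

(* [u] and [d + 1 - u] give the same relation, whence the 2-torsion hypothesis. *)
Lemma straighten_row d (y : nat -> M) :
  (forall z : M, z + z = 0 -> z = 0) -> (0 < d)%N ->
  (forall u, (0 < u <= d)%N ->
     y u - t *: y u.-1 + (y (d.+1 - u)%N - t *: y (d.+1 - u).-1) = 0) ->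
  \sum_(1 <= u < d.+1) strip_coef t (d - u) *: y u = t *: y 0%N.
Proof.
move=> tf d0 yH.
have A0 : \sum_(1 <= u < d.+1) (y u - t *: y u.-1) = 0.
  apply: tf; rewrite {2}big_nat_rev -big_split /= big1_seq // => u.
  by rewrite mem_index_iota => /andP[_ ud]; rewrite add1n subSS yH // -subSS.
(* Now y(1) + ... + y(d) = t (y(0) + ... + y(d-1)); moving the common terms to the left gives the
   claim. *)
move: A0; rewrite sumrB => /eqP; rewrite subr_eq0 -scaler_sumr => /eqP.
rewrite [X in _ = t *: X]big_add1 /= (big_ltn d0) big_nat_recr //= => E0.
rewrite big_nat_recr //= subnn scale1r.
rewrite (_ : \sum_(1 <= u < d) _ = (1 - t) *: \sum_(1 <= u < d) y u); last first.
  rewrite scaler_sumr; apply: eq_big_nat => u /andP[_ ud].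
  by case: (d - u)%N (subn_gt0 u d) => //; rewrite ud.
rewrite scalerBl scale1r addrAC E0 scalerDr addrK //.
Qed.
End Strip.

(** The series (1 - u) / (1 - t u) and (1 - t u) / (1 - u) are inverse to each other; dividing the
    first by 1 - u takes partial sums of [q], which are the powers of t. *)
Lemma strip_coef_inverse (F : fieldType) (K : comNzRingType) (phi : {rmorphism F -> K})
    (t : F) (q : nat -> F) d :
  t != 0 -> q 0%N = 1 -> (forall s, q s.+1 = (1 - t^-1) * t ^+ s.+1) ->
  \sum_(0 <= i < d.+1) phi (q i) * strip_coef (phi t) (d - i) = (d == 0%N)%:R.
Proof.
move=> t0 q0 qS.
have sq s : \sum_(0 <= i < s.+1) q i = t ^+ s.
  elim: s => [|s IH]; first by rewrite big_nat1.
  rewrite big_nat_recr //= IH qS exprS mulrBl mul1r mulKf //; ring.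
have cphi s : strip_coef (phi t) s = phi (strip_coef t s) by case: s => [|s] /=; rewrite ?rmorphB ?rmorph1.
under eq_bigr do rewrite cphi -rmorphM.
rewrite -rmorph_sum -[RHS](rmorph_nat phi); congr (phi _).
case: d => [|d]; first by rewrite big_nat1 q0 mulr1.
rewrite big_nat_recr //= subnn mulr1.
rewrite (_ : \sum_(0 <= i < d.+1) _ = t ^+ d * (1 - t)).
  rewrite qS exprS mulrBl mul1r mulKf //; ring.
rewrite -sq mulr_suml.
by apply: eq_big_nat => i /andP[_ id]; rewrite subSn.
Qed.

(** * Raising and lowering series *)

(* lowering (true) or raising (false); inverse series (true) or not (false);
   pair of rows *)
Definition opidx : Type := (bool * bool) * (nat * nat).

Definition opvec (o : opidx) (i : nat) : int :=
  (if o.1.1 then - (i == o.2.1)%:Z else (i == o.2.1)%:Z) - (i == o.2.2)%:Z.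

Definition shift (alpha : nat -> int) (o : opidx) (s : nat) : nat -> int :=
  fun i => alpha i + opvec o i * s%:Z.

(* Every operator on the rows below [m] decreases this weight, and a product of
   v's vanishes where it is negative: hence all the series are finite. *)
Definition wsum m (alpha : nat -> int) : int :=
  \sum_(i < m) (i.+1)%:Z * alpha i.

Lemma wsum_shift m alpha o s :
  wsum m (shift alpha o s) = wsum m alpha + wsum m (opvec o) * s%:Z.
Proof.
rewrite /wsum mulr_suml -big_split; apply: eq_bigr => i _ /=.
by rewrite /shift mulrDr mulrA.
Qed.

Definition inside m (o : opidx) : bool := (o.2.1 < o.2.2 < m)%N.

Lemma wsum_opvec m o : inside m o -> wsum m (opvec o) < 0.
Proof.
case: o => [[l c] [a b]] /andP[/= ab bm].
have D k : (k < m)%N -> \sum_(i < m) (i.+1)%:Z * (val i == k)%:Z = (k.+1)%:Z.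
  move=> km; rewrite (bigD1 (Ordinal km)) //= eqxx mulr1 big1 ?addr0 // => i.
  by rewrite -val_eqE /= => /negbTE ->; rewrite mulr0.
rewrite /wsum /opvec /=.
under eq_bigr do rewrite mulrBr.
rewrite sumrB D //; case: l; last by rewrite D; lia.
under eq_bigr do rewrite mulrN.
by rewrite sumrN D; lia.
Qed.

Section Ops.
Variables (K : comNzRingType) (M : lmodType K) (opcoef : opidx -> nat -> K).
Implicit Types (f : (nat -> int) -> M) (G : seq opidx) (N m : nat) (alpha : nat -> int).

(* Truncating all series at the same [N] keeps the algebra of operators exact;
   the truncation is invisible where [wsum m alpha < N]. *)
Definition op1 N o f alpha : M := \sum_(0 <= s < N) opcoef o s *: f (shift alpha o s).

Definition opN N G f := foldr (op1 N) f G.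

Lemma shiftC alpha o o' s s' :
  shift (shift alpha o s) o' s' = shift (shift alpha o' s') o s.
Proof. by apply: funext => i; rewrite /shift addrAC. Qed.

Lemma op1C N o o' f : op1 N o (op1 N o' f) = op1 N o' (op1 N o f).
Proof.
apply: funext => alpha; rewrite /op1.
under eq_bigr do rewrite scaler_sumr.
under [RHS]eq_bigr do rewrite scaler_sumr.
rewrite exchange_big; apply: eq_bigr => s _; apply: eq_bigr => s' _.
by rewrite !scalerA mulrC shiftC.
Qed.

Lemma opN_cat N G G' f : opN N (G ++ G') f = opN N G (opN N G' f).
Proof. exact: foldr_cat. Qed.

Lemma opNC N G G' f : opN N G (opN N G' f) = opN N G' (opN N G f).
Proof.
have H o G1 h : op1 N o (opN N G1 h) = opN N G1 (op1 N o h).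
  by elim: G1 => //= o' G1 IH; rewrite op1C IH.
by elim: G => //= o G IH; rewrite IH H.
Qed.

Lemma opN_perm N G G' f : perm_eq G G' -> opN N G f = opN N G' f.
Proof.
move=> /permPl eqG; apply/esym.
apply: (@catCA_perm_ind _ (fun s => opN N s f = opN N G f) _ G) => //.
  by move=> s1 s2 s3 <-; rewrite !opN_cat opNC.
by apply/permPl.
Qed.

(** Used with [P] a negative weight, and with [P] a negative entry in a row that no operator of [G]
    raises. *)
Lemma opN_vanish (P : (nat -> int) -> Prop) N G f alpha :
  (forall beta o s, o \in G -> P beta -> P (shift beta o s)) ->
  (forall beta, P beta -> f beta = 0) -> P alpha -> opN N G f alpha = 0.
Proof.
elim: G alpha => [|o G IH] alpha HP f0 Pa /=; first exact: f0.
rewrite /op1 big1 // => s _; rewrite IH ?scaler0 //.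
  by move=> beta o' s' o'G; apply: HP; rewrite inE o'G orbT.
by apply: HP => //; rewrite inE eqxx.
Qed.

Definition wvanish m f := forall alpha, wsum m alpha < 0 -> f alpha = 0.

Lemma opN_wvanish m N G f : all (inside m) G -> wvanish m f -> wvanish m (opN N G f).
Proof.
move=> /allP gG fm alpha; apply: (opN_vanish (P := fun beta => wsum m beta < 0)) => //.
move=> beta o s /gG /wsum_opvec; rewrite wsum_shift; nia.
Qed.

Lemma op1_stable m N N' o f alpha : inside m o -> wvanish m f ->
  wsum m alpha < N%:Z -> (N <= N')%N -> op1 N' o f alpha = op1 N o f alpha.
Proof.
move=> /wsum_opvec go fm aN NN'; rewrite /op1 (@big_cat_nat _ _ _ N) //=.
rewrite [X in _ + X]big1_seq ?addr0 // => s; rewrite mem_index_iota => ?.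
by rewrite fm ?scaler0 // wsum_shift; nia.
Qed.

Lemma eq_opN m N G f f' alpha : all (inside m) G ->
  (forall beta, wsum m beta <= wsum m alpha -> f beta = f' beta) ->
  opN N G f alpha = opN N G f' alpha.
Proof.
elim: G alpha => [|o G IH] alpha; first by move=> _; apply.
move=> /andP[/wsum_opvec go gG] ff' /=; apply: eq_bigr => s _; congr (_ *: _).
apply: IH => // beta; rewrite wsum_shift => ?; apply: ff'; nia.
Qed.

Lemma opN_stable m N N' G f alpha : all (inside m) G -> wvanish m f ->
  wsum m alpha < N%:Z -> wsum m alpha < N'%:Z -> opN N' G f alpha = opN N G f alpha.
Proof.
wlog NN' : N N' / (N <= N')%N.
  by move=> H gG fm aN aN'; case: (leqP N N') => ?; [|apply/esym]; apply: H => //; lia.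
move=> + fm aN _; elim: G alpha aN => // o G IH alpha aN /andP[go gG] /=.
rewrite (@op1_stable m N) //; last exact: opN_wvanish.
apply: eq_bigr => s _; rewrite IH // wsum_shift.
have := wsum_opvec go; nia.
Qed.

(** The full product of series: for [f] vanishing on negative weights, any truncation bound above
    the weight gives this value. *)
Definition op m G f alpha := opN `|wsum m alpha|.+1 G f alpha.

Lemma op_opN m N G f alpha : all (inside m) G -> wvanish m f ->
  wsum m alpha < N%:Z -> op m G f alpha = opN N G f alpha.
Proof. move=> gG fm aN; apply: (@opN_stable m) => //; lia. Qed.

Lemma op_wvanish m G f : all (inside m) G -> wvanish m f -> wvanish m (op m G f).
Proof. by move=> gG fm alpha a0; rewrite /op (opN_wvanish _ gG fm). Qed.

Lemma op_cat m G G' f : all (inside m) G -> all (inside m) G' -> wvanish m f ->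
  op m (G ++ G') f = op m G (op m G' f).
Proof.
move=> gG gG' fm; apply: funext => alpha.
(* The inner [op] truncates at a bound depending on [beta]; since operators only decrease the
   weight, the outer bound serves for it too. *)
rewrite /op opN_cat; apply: (@eq_opN m) => // beta bD.
by apply/esym; apply: (@op_opN m) => //; lia.
Qed.

Lemma op_perm m G G' f : perm_eq G G' -> op m G f = op m G' f.
Proof. by move=> e; apply: funext => alpha; rewrite /op (opN_perm _ _ e). Qed.

Lemma op_vanish (P : (nat -> int) -> Prop) m G f alpha :
  (forall beta o s, o \in G -> P beta -> P (shift beta o s)) ->
  (forall beta, P beta -> f beta = 0) -> P alpha -> op m G f alpha = 0.
Proof. exact: opN_vanish. Qed.

(** Both series shift along the same vector, so they multiply as power series in one variable. *)
Lemma op_inv1 m o o' f : inside m o -> o'.1.1 = o.1.1 -> o'.2 = o.2 -> wvanish m f ->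
  (forall d, \sum_(0 <= i < d.+1) opcoef o i * opcoef o' (d - i) = (d == 0%N)%:R) ->
  op m [:: o; o'] f = f.
Proof.
case: o => [[l c] p]; case: o' => [[l' c'] p'] /= go el ep fm H; subst l' p'.
apply: funext => alpha; rewrite /op /= /op1.
set N := `|_|.+1.
have sE s s' : shift (shift alpha (l, c, p) s) (l, c', p) s' = shift alpha (l, c, p) (s + s').
  by apply: funext => i; rewrite /shift /opvec /=; lia.
under eq_bigr do [rewrite scaler_sumr; under eq_bigr do rewrite scalerA sE].
rewrite (@big_triangle _ N (fun s s' => (opcoef (l, c, p) s * opcoef (l, c', p) s') *:
   f (shift alpha (l, c, p) (s + s')))); last first.
  move=> a b Nab; rewrite fm ?scaler0 // wsum_shift.
  have := wsum_opvec go; rewrite /N in Nab; nia.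
rewrite big_nat_recl //= big_nat1 big1_seq ?addr0.
  have := H 0%N; rewrite big_nat1 subnn => ->; rewrite scale1r.
  by congr f; apply: funext => i; rewrite /shift mulr0 addr0.
move=> d _.
under eq_big_nat => i id do rewrite subnKC //.
by rewrite -scaler_suml H scale0r.
Qed.

Definition oinv (o : opidx) : opidx := ((o.1.1, ~~ o.1.2), o.2).

Lemma op_inv m G f : all (inside m) G -> wvanish m f ->
  (forall o d, \sum_(0 <= i < d.+1) opcoef o i * opcoef (oinv o) (d - i) = (d == 0%N)%:R) ->
  op m G (op m (map oinv G) f) = f.
Proof.
move=> gG fm H; have gi G1 : all (inside m) G1 -> all (inside m) (map oinv G1).
  by rewrite all_map.
rewrite -op_cat //; last exact: gi.
elim: G gG => [_|o G IH /= /andP[go gG]]; first exact: funext.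
(* Commutativity brings [o] next to its inverse. *)
rewrite (@op_perm _ _ ((G ++ map oinv G) ++ [:: o; oinv o])).
  rewrite op_cat ?op_inv1 ?IH ?all_cat ?gG ?gi //=.
  by apply/and3P.
by apply/permP => p; rewrite /= ?count_cat /= ?count_cat /=; lia.
Qed.

Section Swap.
Variables (tau : nat -> nat) (tauo : opidx -> opidx).

Lemma opN_swap N G f alpha :
  (forall o, o \in G -> opvec (tauo o) =1 opvec o \o tau /\ opcoef (tauo o) =1 opcoef o) ->
  opN N (map tauo G) f (alpha \o tau) = opN N G (fun beta => f (beta \o tau)) alpha.
Proof.
elim: G alpha => //= o G IH alpha H; apply: eq_bigr => s _.
have [Ho ->] : opvec (tauo o) =1 opvec o \o tau /\ opcoef (tauo o) =1 opcoef o by apply: H; rewrite inE eqxx.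
congr (_ *: _).
rewrite -IH; last by move=> o' o'G; apply: H; rewrite inE o'G orbT.
by congr opN; apply: funext => i; rewrite /shift Ho.
Qed.
End Swap.

Lemma opN_exponents N G f alpha :
  opN N G f alpha =
  \sum_(e <- exponents N (size G)) (\prod_(p <- zip G e) opcoef p.1 p.2) *:
     f (fun i => alpha i + \sum_(p <- zip G e) opvec p.1 i * p.2%:Z).
Proof.
elim: G alpha => [|o G IH] alpha /=.
  rewrite big_exponents0 /= big_nil scale1r; congr f; apply: funext => i.
  by rewrite big_nil addr0.
rewrite big_exponentsS; apply: eq_bigr => s _; rewrite IH scaler_sumr.
apply: eq_bigr => e _; rewrite big_cons scalerA; congr (_ *: f _).
by apply: funext => i; rewrite big_cons /shift addrA.
Qed.

End Ops.

(** A factor depending only on a row that the operators leave alone behaves as a constant. *)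
Lemma opN_mulr (K : comNzRingType) (M : comAlgType K) (opcoef : opidx -> nat -> K) N G
   (f : (nat -> int) -> M) (c : int -> M) n alpha :
  (forall o, o \in G -> opvec o n = 0) ->
  opN opcoef N G (fun beta => f beta * c (beta n)) alpha = opN opcoef N G f alpha * c (alpha n).
Proof.
elim: G alpha => //= o G IH alpha H; rewrite /op1 mulr_suml; apply: eq_bigr => s _.
rewrite IH; last by move=> o' o'G; apply: H; rewrite inE o'G orbT.
by rewrite -scalerAl {2}/shift H ?mul0r ?addr0 // inE eqxx.
Qed.

(** * The Pieri expansion on rows *)

Section Vertex.
Variables (K : comNzRingType) (M : comAlgType K) (tq theta : K) (rc : nat -> K).
Variable v : int -> M.
(** [rc0], [rc1] and [rcS] say that (1 - t u) times the series of [rc] is 1 - u; [rc_conv] says that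
    the inverse series is (1 - t u) / (1 - u). *)
Hypothesis rc0 : rc 0 = 1.
Hypothesis rc1 : rc 1 - tq = - 1.
Hypothesis rcS : forall s, rc s.+2 = tq * rc s.+1.
Hypothesis rc_conv : forall d,
  \sum_(0 <= i < d.+1) rc i * strip_coef tq (d - i) = (d == 0%N)%:R.
Hypothesis v_neg : forall k : int, k < 0 -> v k = 0.
Hypothesis torsion2 : forall z : M, z + z = 0 -> z = 0.

Definition opcoef (o : opidx) (s : nat) : K :=
  (if o.1.2 then strip_coef tq s else rc s) * (if o.1.1 then theta ^+ s else 1).

Lemma opcoef_inverse o d :
  \sum_(0 <= i < d.+1) opcoef o i * opcoef (oinv o) (d - i) = (d == 0%N)%:R.
Proof.
rewrite /opcoef /=.
transitivity ((\sum_(0 <= i < d.+1) rc i * strip_coef tq (d - i)) *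
  (if o.1.1 then theta ^+ d else 1)).
  rewrite mulr_suml; case: o.1.2 => /=.
    rewrite big_nat_rev /= add0n; apply: eq_big_nat => i /andP[_ id].
    rewrite subSS subKn //; case: o.1.1; last by rewrite !mulr1 mulrC.
    rewrite (_ : theta ^+ d = theta ^+ (d - i) * theta ^+ i); first ring.
    by rewrite -exprD subnK.
  apply: eq_big_nat => i /andP[_ id].
  case: o.1.1; rewrite ?mulr1 //.
  rewrite (_ : theta ^+ d = theta ^+ (d - i) * theta ^+ i); first ring.
  by rewrite -exprD subnK.
rewrite rc_conv; case: d => [|d]; rewrite ?mul0r //= mul1r.
by case: o.1.1.
Qed.

Definition base m (alpha : nat -> int) : M := \prod_(i < m) v (alpha i).

Lemma base_neg m alpha i : (i < m)%N -> alpha i < 0 -> base m alpha = 0.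
Proof.
move=> im; rewrite /base (bigD1 (Ordinal im)) //=.
by move=> ai; rewrite v_neg // mul0r.
Qed.

(** The weights i + 1 are positive, so a negative total forces a negative entry. *)
Lemma base_wvanish m : wvanish m (base m).
Proof.
move=> alpha; rewrite /wsum => H.
case: (boolP [forall i : 'I_m, 0 <= alpha i]) => [/forallP a0|/forallPn[i]].
  by move: H; rewrite ltNge sumr_ge0 // => i _; rewrite mulr_ge0.
by rewrite -ltNge => ?; apply: (@base_neg _ _ i).
Qed.

(** * Straightening at the adjacent rows i and i + 1 *)

Section Straighten.
Variable i : nat.

Definition tau (k : nat) : nat := if k == i then i.+1 else if k == i.+1 then i else k.

(* L_(i,i+1) is symmetric in the two rows: it is kept, as the swapped pair would
   not be increasing. *)
Definition tauo (o : opidx) : opidx :=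
  if o.2 == (i, i.+1) then o else (o.1, (tau o.2.1, tau o.2.2)).

Definition Rop : opidx := ((false, false), (i, i.+1)).

Lemma tauK : involutive tau.
Proof. by move=> k; rewrite /tau; repeat (case: eqP => //=); lia. Qed.

Lemma tauoK m o : inside m o -> tauo (tauo o) = o.
Proof.
case: o => [[l c] [a b]] /andP[/= ab bm]; rewrite /tauo /=.
have [abE|abN] := eqVneq (a, b) (i, i.+1); first by rewrite /= abE eqxx.
rewrite /= !tauK ifF //; apply/negbTE; rewrite xpair_eqE /tau.
by repeat (case: eqP => //=); lia.
Qed.

Lemma inside_tauo m o : (i.+1 < m)%N -> inside m o -> inside m (tauo o).
Proof.
case: o => [[l c] [a b]]; rewrite /inside /tauo /= => im; case: ifPn => //=.
rewrite xpair_eqE /tau; repeat (case: eqP => //=); lia.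
Qed.

Lemma opvec_tauo m o : inside m o -> o.1.1 || (o.2 != (i, i.+1)) ->
  opvec (tauo o) =1 opvec o \o tau.
Proof.
case: o => [[l c] [a b]] /andP[/= ab _] H k; rewrite /tauo /opvec /=.
have E x : (tau k == x) = (k == tau x) by rewrite -(inj_eq (can_inj tauK)) tauK.
move: H; have [[-> ->]|_] := eqVneq (a, b) (i, i.+1) => /= H; last by rewrite !E.
rewrite orbF in H; rewrite H !E /tau eqxx.
by rewrite (_ : (i.+1 == i) = false) ?eqxx; lia.
Qed.

(** A general list [G] covers V and W at once: it contains R_(i,i+1) and is otherwise closed under
    exchanging the two rows. *)
Variables (m : nat) (G : seq opidx).
Hypothesis im : (i.+1 < m)%N.
Hypothesis uG : uniq G.
Hypothesis gG : all (inside m) G.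
Hypothesis nG : {in G, forall o, ~~ o.1.2}.
Hypothesis RG : Rop \in G.
Hypothesis sG : {in G, forall o, o != Rop -> tauo o \in G}.

Lemma base_tau alpha : base m (alpha \o tau) = base m alpha.
Proof.
have tm (k : 'I_m) : (tau k < m)%N.
  by case: k => k /= km; rewrite /tau; repeat (case: eqP => //=); lia.
rewrite /base [RHS](reindex (fun k => Ordinal (tm k))) //=.
by exists (fun k => Ordinal (tm k)) => k _; apply: val_inj; rewrite /= tauK.
Qed.

Let G0 := rem Rop G.

Lemma memG0 o : (o \in G0) = (o != Rop) && (o \in G).
Proof. by rewrite /G0 mem_rem_uniq // inE. Qed.

Lemma opvec_tauo_G0 o : o \in G0 -> opvec (tauo o) =1 opvec o \o tau.
Proof.
rewrite memG0 => /andP[oR oG]; apply: (@opvec_tauo m); first exact: (allP gG).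
case: o oR oG => [[l c] p] oR /nG /= cF.
case: l oR => //= oR; apply: contra oR => /eqP->.
by case: c cF.
Qed.

Lemma perm_tauo : perm_eq [seq tauo o | o <- G0] G0.
Proof.
have uG0 : uniq G0 by apply: rem_uniq.
have iG0 o : o \in G0 -> inside m o by rewrite memG0 => /andP[_ /(allP gG)].
have uT : uniq [seq tauo o | o <- G0].
  rewrite map_inj_in_uniq // => o o' /iG0 io /iG0 io' /(congr1 tauo).
  by rewrite (tauoK io) (tauoK io').
apply: uniq_perm => //.
apply: (uniq_min_size _ _ _).2 => //; last by rewrite size_map.
move=> _ /mapP[o oG0 ->]; move: (oG0); rewrite memG0 => /andP[oR oG].
rewrite memG0 sG // andbT; apply: contra oR => /eqP /(congr1 tauo).
by rewrite (tauoK (iG0 _ oG0)) /tauo /= eqxx => ->.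
Qed.

Let V := op opcoef m G (base m).
Let U := op opcoef m G0 (base m).

Lemma gG0 : all (inside m) G0.
Proof. by apply/allP => o; rewrite memG0 => /andP[_ /(allP gG)]. Qed.

(** The exchange permutes the operators other than R_(i,i+1) and fixes the commutative product
    [base]. *)
Lemma U_tau alpha : U (alpha \o tau) = U alpha.
Proof.
pose N := (`|wsum m alpha| + `|wsum m (alpha \o tau)|).+1.
rewrite /U !(@op_opN _ _ _ _ N) ?gG0 //; try exact: base_wvanish; try by rewrite /N; lia.
rewrite -[in LHS](opN_perm _ _ _ perm_tauo) opN_swap; last first.
  by move=> o oG0; split; [exact: opvec_tauo_G0 | rewrite /opcoef /tauo; case: ifP].
by rewrite (_ : (fun beta => _) = base m) //; apply: funext => beta; rewrite base_tau.
Qed.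

(** V is (1 - R) / (1 - t R) applied to U; multiplying by 1 - t R clears the denominator of the only
    asymmetric factor. *)
Lemma V_U alpha :
  V alpha - tq *: V (shift alpha Rop 1) = U alpha - U (shift alpha Rop 1).
Proof.
have VE : V = op opcoef m [:: Rop] U.
  rewrite /V (@op_perm _ _ _ m _ ([:: Rop] ++ G0)); first rewrite op_cat ?gG0 //.
  - by rewrite /= andbT (allP gG).
  - exact: base_wvanish.
  - exact: perm_to_rem.
have Uv : wvanish m U by apply: op_wvanish; [exact: gG0|exact: base_wvanish].
have iR : all (inside m) [:: Rop] by rewrite /= andbT (allP gG).
pose N := (`|wsum m alpha| + `|wsum m (shift alpha Rop 1)|).+2.
rewrite VE !(@op_opN _ _ _ _ N) //; try by rewrite /N; lia.
rewrite /= /op1 {}/N; set n := (_ + _)%N.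
have sh0 : shift alpha Rop 0 = alpha by apply: funext => k; rewrite /shift mulr0 addr0.
have shS s : shift (shift alpha Rop 1) Rop s = shift alpha Rop s.+1.
  by apply: funext => k; rewrite /shift; lia.
have cR s : opcoef Rop s = rc s by rewrite /opcoef /= mulr1.
under eq_bigr do rewrite cR.
under [in X in _ - X]eq_bigr do rewrite cR shS.
rewrite big_nat_recl // big_nat_recl //= [X in tq *: X]big_nat_recl //=.
(* The extra top term of the shifted truncated series dies by its negative weight, so the relation
   is exact. *)
have Un : U (shift alpha Rop n.+2) = 0.
  by apply: Uv; rewrite wsum_shift; have := wsum_opvec (allP gG _ RG); rewrite /n; nia.
rewrite [X in tq *: (_ + X)]big_nat_recr //= Un scaler0 addr0 sh0 rc0 !scale1r.
rewrite -addrA; congr (_ + _); rewrite scalerDr opprD addrACA.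
rewrite -scalerBl rc1 scaleN1r scaler_sumr.
rewrite (eq_bigr (fun s => tq *: (rc s.+1 *: U (shift alpha Rop s.+2)))) ?subrr ?addr0 //.
by move=> s _; rewrite scalerA -rcS.
Qed.

(** The right-hand side of [V_U] is antisymmetric: [alpha'] and its raised vector are the exchanges
    of the raised [alpha] and of [alpha]. *)
Lemma V_straight alpha (alpha' := shift alpha Rop 1 \o tau) :
  V alpha - tq *: V (shift alpha Rop 1) +
  (V alpha' - tq *: V (shift alpha' Rop 1)) = 0.
Proof.
have -> : V alpha' - tq *: V (shift alpha' Rop 1) = U (shift alpha Rop 1) - U alpha.
  rewrite V_U; congr (_ - _); first exact: U_tau.
  rewrite -[RHS]U_tau; congr U; apply: funext => k.
  rewrite /alpha' /shift /opvec /= mulr1 mulr1 /tau.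
  by repeat (case: eqP => //=); lia.
by rewrite V_U addrC subrKA subrr.
Qed.

Definition set2 (alpha : nat -> int) (b c : int) : nat -> int :=
  fun k => if k == i then b else if k == i.+1 then c else alpha k.

Lemma op_straighten alpha (x : int) d : (0 < d)%N ->
  \sum_(1 <= u < d.+1)
     strip_coef tq (d - u) *: V (set2 alpha (x - u%:Z) (x - (d - u)%:Z)) =
  tq *: V (set2 alpha x (x - d%:Z)).
Proof.
move=> d0.
pose y u := V (set2 alpha (x - u%:Z) (x - d%:Z + u%:Z)).
transitivity (\sum_(1 <= u < d.+1) strip_coef tq (d - u) *: y u).
  apply: eq_big_nat => u ud; congr (_ *: V (set2 _ _ _)); lia.
rewrite straighten_row //; first by rewrite /y subr0 addr0.
move=> u /andP[u0 ud].
(* Raising turns u into u - 1, and the exchanged vector is the one belonging to d + 1 - u. *)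
rewrite -[RHS](V_straight (set2 alpha (x - u%:Z) (x - d%:Z + u%:Z))).
congr (_ - _ *: V _ + (V _ - _ *: V _)); apply: funext => k;
  rewrite /set2 /shift /opvec /tau /= ?mulr1; repeat (case: eqP => //=); lia.
Qed.

End Straighten.

Definition incpairs m : seq (nat * nat) := [seq (a, b) | b <- iota 0 m, a <- iota 0 b].

Lemma mem_incpairs m p : (p \in incpairs m) = (p.1 < p.2 < m)%N.
Proof.
apply/allpairsPdep/andP => [[b [a [+ + ->]]]|[p12 p2m]].
  by rewrite !mem_iota /= !add0n => -> ->.
by exists p.2, p.1; rewrite !mem_iota /= !add0n p12 p2m -surjective_pairing.
Qed.

Lemma incpairs_uniq m : uniq (incpairs m).
Proof.
apply: allpairs_uniq_dep => [|b _|]; rewrite ?iota_uniq //.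
by move=> [b a] [b' a'] _ _ /= [-> ->].
Qed.

Definition pairs m : seq opidx :=
  [seq ((true, false), p) | p <- incpairs m] ++ [seq ((false, false), p) | p <- incpairs m].

Lemma mem_pairs m o : (o \in pairs m) = ~~ o.1.2 && inside m o.
Proof.
have mp (l c : bool) : (o \in [seq ((l, c), p) | p <- incpairs m]) = (o.1 == (l, c)) && inside m o.
  apply/mapP/andP => [[p pm ->]|[/eqP o1 io]].
    by rewrite eqxx /inside /= -mem_incpairs.
  by exists o.2; rewrite ?mem_incpairs // -o1 -surjective_pairing.
by rewrite mem_cat !mp; case: o {mp} => [[[] []] p] /=; rewrite ?orbF.
Qed.

Lemma pairs_uniq m : uniq (pairs m).
Proof.
have inj l c : injective (pair (l, c) : nat * nat -> opidx) by move=> ? ? [].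
rewrite cat_uniq !map_inj_uniq ?incpairs_uniq ?andbT //=; try exact: inj.
by apply/hasPn => _ /mapP[p _ ->]; apply/negP => /mapP[].
Qed.

Lemma inside_pairs m : all (inside m) (pairs m).
Proof. by apply/allP => o; rewrite mem_pairs => /andP[]. Qed.

Lemma insideS m o : inside m o -> inside m.+1 o.
Proof. rewrite /inside; lia. Qed.

Lemma inside_pairsS m : all (inside m.+1) (pairs m).
Proof. by apply/allP => o; rewrite mem_pairs => /andP[_ /insideS]. Qed.

Definition lastops (l c : bool) n : seq opidx := [seq ((l, c), (a, n)) | a <- iota 0 n].

Lemma mem_lastops l c n o :
  (o \in lastops l c n) = [&& o.1 == (l, c), o.2.2 == n & (o.2.1 < n)%N].
Proof.
apply/mapP/and3P => [[a + ->]|[/eqP o1 /eqP o2 on]]; first by rewrite mem_iota.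
by exists o.2.1; rewrite ?mem_iota // -o1 -o2 -!surjective_pairing.
Qed.

Lemma lastops_uniq l c n : uniq (lastops l c n).
Proof. by rewrite map_inj_uniq ?iota_uniq // => a b []. Qed.

Lemma inside_lastops l c n : all (inside n.+1) (lastops l c n).
Proof. by apply/allP => o; rewrite mem_lastops /inside => /and3P[_ /eqP -> ->] /=. Qed.

Definition Vn n := op opcoef n (pairs n) (base n).

(* prod_(i <= n) (1 - theta z_i u) / (1 - t theta z_i u) times V(z) v(u) *)
Definition Wn n := op opcoef n.+1 (lastops true false n ++ pairs n) (base n.+1).

Lemma inside_W n : all (inside n.+1) (lastops true false n ++ pairs n).
Proof. by rewrite all_cat inside_lastops inside_pairsS. Qed.

(** The factor v becomes one more row, touched by no operator. *)
Lemma Vn_mul n alpha :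
  Vn n alpha * v (alpha n) = op opcoef n.+1 (pairs n) (base n.+1) alpha.
Proof.
pose N := (`|wsum n alpha| + `|wsum n.+1 alpha|).+1.
rewrite /Vn !(@op_opN _ _ _ _ N) ?inside_pairs ?inside_pairsS //;
  try exact: base_wvanish; try by rewrite /N; lia.
rewrite -(@opN_mulr _ _ _ _ _ _ v n); last first.
  move=> [[l c] [a b]]; rewrite mem_pairs /opvec /inside /= => ?.
  by rewrite !gtn_eqF; [case: l | lia | lia].
by congr opN; apply: funext => beta; rewrite /base big_ord_recr.
Qed.

Lemma map_oinv_lastops l c n : [seq oinv o | o <- lastops l c n] = lastops l (~~ c) n.
Proof. by rewrite -map_comp; apply: eq_map => a. Qed.

(** W arises from the product by the series in L_(i,n+1); the inverse series undo this. *)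
Lemma mulVn_Wn n alpha :
  Vn n alpha * v (alpha n) = op opcoef n.+1 (lastops true true n) (Wn n) alpha.
Proof.
have bv := @base_wvanish n.+1.
have pv := op_wvanish opcoef (inside_pairsS n) bv.
rewrite Vn_mul /Wn op_cat ?inside_lastops ?inside_pairsS //.
rewrite -(map_oinv_lastops true true) op_inv ?inside_lastops //.
exact: opcoef_inverse.
Qed.

(* the last rows are listed backwards to match the reversal in [Wn_Vn_sum] *)
Definition rlastops n : seq opidx := [seq ((false, true), (n - a.+1, n)%N) | a <- iota 0 n].

Lemma perm_rlastops n : perm_eq (rlastops n) (lastops false true n).
Proof.
have ui : uniq (rlastops n).
  rewrite map_inj_in_uniq ?iota_uniq // => a b; rewrite !mem_iota => ? ? []; lia.
apply: uniq_perm; rewrite ?lastops_uniq //.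
apply: (uniq_min_size _ _ _).2 => //; last by rewrite !size_map.
move=> _ /mapP[a + ->]; rewrite mem_iota mem_lastops /= eqxx => ?; lia.
Qed.

(** W lacks exactly the operators R_(i,n+1) of V on n + 1 rows, so inverting those recovers it. *)
Lemma Wn_Vn n alpha : Wn n alpha = op opcoef n.+1 (rlastops n) (Vn n.+1) alpha.
Proof.
rewrite (op_perm _ _ _ (perm_rlastops n)).
have -> : Vn n.+1 = op opcoef n.+1 (lastops false false n) (Wn n).
  have bv := @base_wvanish n.+1.
  rewrite /Wn -op_cat ?inside_W ?inside_lastops //.
  apply: op_perm; apply: uniq_perm; first exact: pairs_uniq.
    rewrite cat_uniq lastops_uniq cat_uniq lastops_uniq pairs_uniq andbT /=.
    apply/andP; split; apply/hasPn => o; last rewrite mem_pairs;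
      rewrite 1?mem_cat ?mem_pairs ?mem_lastops /inside;
      by case: o => [[[] []] [a b]] //= ?; rewrite ?mem_lastops /=; lia.
  move=> o; rewrite mem_pairs mem_cat mem_lastops mem_cat mem_lastops mem_pairs /inside.
  case: o => [[[] []] [a b]] //=; lia.
rewrite -(map_oinv_lastops false true) op_inv ?inside_lastops //.
  apply: op_wvanish; [exact: inside_W | exact: base_wvanish].
exact: opcoef_inverse.
Qed.

Lemma big_zip_iota (R : Type) (idx : R) (opr : Monoid.law idx) (T : Type)
    (F : nat -> T) (Gf : T -> nat -> R) n (e : seq nat) : size e = n ->
  \big[opr/idx]_(p <- zip [seq F a | a <- iota 0 n] e) Gf p.1 p.2 =
  \big[opr/idx]_(0 <= a < n) Gf (F a) (nth 0%N e a).
Proof.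
move=> <-; rewrite -[X in zip _ X](mkseq_nth 0%N e) /mkseq.
by rewrite zip_map big_map /index_iota subn0.
Qed.

Definition embed (l : seq int) : nat -> int := nth 0 l.

(* Reversal and negation turn adding boxes from the last row upwards into removing
   boxes from the first row downwards. *)
Definition negrev (l : seq int) : seq int := rev [seq - z | z <- l].

Lemma negrev_cat l1 l2 : negrev (l1 ++ l2) = negrev l2 ++ negrev l1.
Proof. by rewrite /negrev map_cat rev_cat. Qed.

Lemma size_negrev l : size (negrev l) = size l.
Proof. by rewrite size_rev size_map. Qed.

Lemma nth_negrev l i : nth 0 (negrev l) i = if (i < size l)%N then - nth 0 l (size l - i.+1) else 0.
Proof.
case: ltnP => il; last by rewrite nth_default ?size_negrev.
by rewrite nth_rev ?size_map // (nth_map 0) // -subSn // subSS leq_subr.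
Qed.

Lemma size_lowered l e : size e = size l -> size (lowered l e) = size l.
Proof. by move=> se; rewrite size_map size_zip se minnn. Qed.

Lemma nth_lowered l e i : size e = size l ->
  nth 0 (lowered l e) i = nth 0 l i - (nth 0%N e i)%:Z.
Proof.
move=> se; case: (ltnP i (size l)) => il; last first.
  by rewrite !nth_default ?size_lowered ?se.
by rewrite (nth_map (0, 0%N)) ?size_zip ?se ?minnn // nth_zip.
Qed.

Lemma sum_delta n i (x : nat -> int) :
  \sum_(0 <= a < n) (i == a)%:Z * x a = if (i < n)%N then x i else 0.
Proof.
elim: n => [|n IH]; first by rewrite big_geq.
rewrite big_nat_recr //= IH ltnS.
by case: (ltngtP i n) => [_|_|->] /=; lia.
Qed.

Lemma sumn_nth e n : size e = n -> (sumn e)%:Z = \sum_(0 <= a < n) (nth 0%N e a)%:Z.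
Proof. by move=> <-; rewrite sumnE (big_nth 0%N) (big_morph Posz PoszD (erefl : Posz 0 = 0)). Qed.

Lemma free_weight_prod e : free_weight tq tq e = \prod_(0 <= a < size e) strip_coef tq (nth 0%N e a).
Proof.
rewrite -(big_nth 0%N predT (strip_coef tq)).
by elim: e => [|s e IH] /=; rewrite ?big_nil // big_cons -IH.
Qed.

Lemma theta_exp_prod e : theta ^+ sumn e = \prod_(0 <= a < size e) theta ^+ nth 0%N e a.
Proof. by rewrite sumnE expr_sum (big_nth 0%N). Qed.

(** Each L_(i,n+1) lowers both of its rows, so the last row loses the total of [e]. *)
Lemma opN_lower_exponents N n l b (f : (nat -> int) -> M) : size l = n ->
  opN opcoef N (lastops true true n) f (embed (rcons l b)) =
  \sum_(e <- exponents N n) (free_weight tq tq e * theta ^+ sumn e) *: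
     f (embed (rcons (lowered l e) (b - (sumn e)%:Z))).
Proof.
move=> sl; rewrite opN_exponents size_map size_iota big_seq [RHS]big_seq.
apply: eq_bigr => e; rewrite mem_exponents => /andP[/eqP se _].
rewrite big_zip_iota // free_weight_prod theta_exp_prod se -big_split /=.
congr (_ *: f _); apply: funext => i.
rewrite (big_zip_iota _ _ (fun o s => opvec o i * s%:Z)) // /opvec /=.
rewrite /embed !nth_rcons size_lowered ?se ?sl // nth_lowered ?se ?sl //.
under eq_bigr do rewrite mulrBl mulNr.
rewrite sumrB sumrN sum_delta -mulr_sumr -sumn_nth //.
by case: (ltngtP i n) => ? /=; lia.
Qed.

(** Each R_(i,n+1) moves boxes from the last row up to row i; seen through [negrev], row i is
    lowered. *)
Lemma opN_raise_exponents N n l b (f : (nat -> int) -> M) : size l = n ->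
  opN opcoef N (rlastops n) f (embed (rcons l b)) =
  \sum_(e <- exponents N n) free_weight tq tq e *:
     f (embed (rcons (negrev (lowered (negrev l) e)) (b - (sumn e)%:Z))).
Proof.
move=> sl; rewrite opN_exponents size_map size_iota big_seq [RHS]big_seq.
apply: eq_bigr => e; rewrite mem_exponents => /andP[/eqP se _].
rewrite big_zip_iota // free_weight_prod se.
under eq_bigr do rewrite /opcoef /= mulr1.
congr (_ *: f _); apply: funext => i.
rewrite (big_zip_iota _ _ (fun o s => opvec o i * s%:Z)) // /opvec /=.
have sn := size_negrev l.
rewrite /embed !nth_rcons size_negrev size_lowered ?se ?sn ?sl //.
rewrite nth_negrev size_lowered ?se ?sn ?sl // nth_lowered ?se ?sn ?sl //.
rewrite nth_negrev sl.
under eq_bigr do rewrite mulrBl.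
rewrite sumrB -mulr_sumr -sumn_nth //.
rewrite (_ : \sum_(0 <= a < n) _ =
  \sum_(0 <= a < n) ((i < n)%N && (n - i.+1 == a)%N)%:Z * (nth 0%N e a)%:Z); last first.
  by apply: eq_big_nat => a an; congr (_%:Z * _); lia.
case: (ltngtP i n) => ilt /=.
- have E1 : (n - i.+1 < n)%N by lia.
  rewrite sum_delta !E1 (_ : n - (n - i.+1).+1 = i)%N; lia.
- by rewrite big1; [lia | move=> a _; rewrite mul0r].
- by rewrite big1; [lia | move=> a _; rewrite mul0r].
Qed.

Lemma embed_set2 l1 b c l2 :
  embed (l1 ++ b :: c :: l2) = set2 (size l1) (embed (l1 ++ 0 :: 0 :: l2)) b c.
Proof.
apply: funext => k; rewrite /embed /set2 !nth_cat.
case: (ltngtP k (size l1)) => kl; rewrite ?kl ?subnn //.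
  by rewrite ifF //; apply/eqP; lia.
case: eqP => [->|kn]; first by rewrite subSn ?subnn.
by have -> : (k - size l1 = (k - size l1).-2.+2)%N by lia.
Qed.

Lemma wsum_le m (alpha beta : nat -> int) :
  (forall i, alpha i <= beta i) -> wsum m alpha <= wsum m beta.
Proof. by move=> le; apply: ler_sum => i _; rewrite ler_pM2l. Qed.

Lemma Vn_ext n alpha beta : (forall i, (i < n)%N -> alpha i = beta i) ->
  Vn n alpha = Vn n beta.
Proof.
move=> ab; rewrite /Vn /op (_ : wsum n beta = wsum n alpha); last first.
  by apply: eq_bigr => i _; rewrite ab.
move: `|_|.+1 => N; elim: (pairs n) alpha beta ab => [|o G IH] alpha beta ab /=.
  by apply: eq_bigr => i _; rewrite ab.
apply: eq_bigr => s _; congr (_ *: _); apply: IH => i i_n.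
by rewrite /shift ab.
Qed.

(** The last row is only ever the second index of a pair, hence never raised. *)
Lemma Vn_neg n alpha : alpha n < 0 -> Vn n.+1 alpha = 0.
Proof.
apply: (@op_vanish _ _ _ (fun beta => beta n < 0)); last by move=> beta; apply: base_neg.
move=> beta [[l c] [a b]] s; rewrite mem_pairs /inside /shift /opvec /= => ? ?.
by case: l => /=; nia.
Qed.

(** Here k is n or n - 1. Row n - 1 is never raised either: it could be a first index only in a pair
    with row n, and W has no raising operator there. *)
Lemma Wn_neg n alpha k : (k <= n)%N -> (n <= k.+1)%N -> alpha k < 0 -> Wn n alpha = 0.
Proof.
move=> kn nk; apply: (@op_vanish _ _ _ (fun beta => beta k < 0)); last first.
  by move=> beta; apply: base_neg.
move=> beta [[[] []] [a b]] s;
  rewrite mem_cat mem_pairs mem_lastops /inside /shift /opvec /= ?xpair_eqE //= => ? ?; nia.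
Qed.

(** Reversal with negation preserves the form of the relation, m becoming d - m. *)
Lemma Vn_straightens n :
  straightens tq n (fun l (_ : nat) => Vn n (embed (negrev l))).
Proof.
move=> _ l1 l2 m d sl d0; pose i := size l2.
have E b c : embed (negrev (l1 ++ b :: c :: l2)) =
    set2 i (embed (negrev l2 ++ 0 :: 0 :: negrev l1)) (- c) (- b).
  rewrite negrev_cat (negrev_cat [:: b; c] l2) -catA /negrev /= /rev /=.
  by rewrite embed_set2 size_negrev.
have im : (i.+1 < n)%N by rewrite -sl /i; lia.
rewrite E.
transitivity (\sum_(1 <= u < d.+1) strip_coef tq (d - u) *:
  Vn n (set2 i (embed (negrev l2 ++ 0 :: 0 :: negrev l1)) ((d%:Z - m) - u%:Z) ((d%:Z - m) - (d - u)%:Z))).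
  apply: eq_big_nat => u ud; rewrite E; congr (_ *: Vn n (set2 _ _ _ _)); lia.
rewrite (op_straighten im) //.
- by congr (_ *: Vn n (set2 _ _ _ _)); lia.
- exact: pairs_uniq.
- exact: inside_pairs.
- by move=> o; rewrite mem_pairs => /andP[].
- by rewrite mem_pairs /inside /= leqnn.
- move=> o; rewrite !mem_pairs => /andP[o1 io] _; rewrite inside_tauo // andbT.
  by rewrite /tauo; case: ifP.
Qed.

Lemma mem_W n o : (o \in lastops true false n ++ pairs n) =
  [&& ~~ o.1.2, inside n.+1 o & o.1.1 || (o.2.2 < n)%N].
Proof.
by rewrite mem_cat mem_lastops mem_pairs /inside; case: o => [[[] []] [x y]] //=; lia.
Qed.

(** W contains every L_(j,n+1) and no R_(j,n+1), so exchanging two of the first n rows permutes its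
    operators apart from the R of these two rows. *)
Lemma Wn_straightens n (r : int) :
  straightens tq n (fun l a => Wn n (embed (rcons l (r - a%:Z)))).
Proof.
move=> a l1 l2 m d sl d0; pose i := size l1.
have E b c : embed (rcons (l1 ++ b :: c :: l2) (r - a%:Z)) =
    set2 i (embed (l1 ++ 0 :: 0 :: rcons l2 (r - a%:Z))) b c.
  by rewrite rcons_cat /= embed_set2.
have im : (i.+1 < n)%N by rewrite -sl /i; lia.
rewrite E; under eq_bigr do rewrite E.
rewrite (op_straighten (leqW im)) //.
- rewrite cat_uniq lastops_uniq pairs_uniq andbT; apply/hasPn => o.
  by rewrite mem_pairs /= mem_lastops /inside; case: o => [[[] []] [x y]] //=; lia.
- exact: inside_W.
- by move=> o; rewrite mem_W => /and3P[].
- by rewrite mem_W /inside /=; lia.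
- move=> o; rewrite !mem_W => /and3P[o1 io oy] _.
  rewrite inside_tauo ?(leqW im) //= /tauo; case: ifP => _ //=.
    by rewrite o1.
  rewrite o1 /=; case: (o.1.1) oy => //=; rewrite /tau; repeat (case: eqP => //=); lia.
Qed.

Lemma fits_rcons l z e : size e = size l ->
  fits (rcons l z) e = fits l e && ((l == [::]) || ((last 0%N e)%:Z <= last 0 l - z)).
Proof.
elim: l e => [|m1 [|m2 l] IH] [|s e] //=; first by case: e => //; rewrite andbT.
case: e => // s' e se; have := IH (s' :: e) (succn_inj se).
by rewrite rcons_cons -andbA /= => ->.
Qed.

Lemma Vn_Wn N n l (r : nat) : size l = n -> sorted >=%R l ->
  wsum n.+1 (embed (rcons l r%:Z)) < N%:Z -> (r < N)%N ->
  Vn n (embed l) * v r%:Z =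
  \sum_(e <- exponents N n | fits (rcons l 0) e && (sumn e <= r)%N)
     (strip_weight tq tq l e * theta ^+ sumn e) *: Wn n (embed (rcons (lowered l e) (r - sumn e)%N%:Z)).
Proof.
move=> sl srt lN rN.
have -> : Vn n (embed l) * v r%:Z = Vn n (embed (rcons l r%:Z)) * v (embed (rcons l r%:Z) n).
  rewrite /embed nth_rcons sl ltnn eqxx; congr (_ * _); apply: Vn_ext => i i_n.
  by rewrite nth_rcons sl i_n.
have Wv : wvanish n.+1 (Wn n) by apply: op_wvanish; [exact: inside_W | exact: base_wvanish].
rewrite mulVn_Wn (@op_opN _ _ _ _ N) ?inside_lastops // opN_lower_exponents //.
(* The cut at [r] makes [f] vanish at large totals, as [strip_sum] requires. *)
pose f (l' : seq int) a : M :=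
  if (a <= r)%N then theta ^+ a *: Wn n (embed (rcons l' (r%:Z - a%:Z))) else 0.
transitivity (\sum_(e <- exponents N (size l)) free_weight tq tq e *: f (lowered l e) (sumn e)).
  rewrite sl big_seq [RHS]big_seq; apply: eq_bigr => e; rewrite mem_exponents => /andP[/eqP se _].
  rewrite /f; case: leqP => er; first by rewrite scalerA.
  (* More than [r] boxes make the last row negative. *)
  rewrite (@Wn_neg _ _ n) ?scaler0 //.
  by rewrite /embed nth_rcons size_lowered ?se ?sl // ltnn eqxx; lia.
rewrite strip_sum //; first last.
- by move=> l' a Na; rewrite /f ifF //; apply/negbTE; lia.
- rewrite sl => a l1 l2 m d sz d0; rewrite /f; case: leqP => _; last first.
    by rewrite big1 ?scaler0 // => u _; rewrite scaler0.
  under eq_bigr do rewrite scalerA mulrC -scalerA.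
  by rewrite -scaler_sumr (Wn_straightens r%:Z) // !scalerA mulrC.
rewrite sl big_seq_cond [RHS]big_seq_cond big_mkcond [RHS]big_mkcond /=.
apply: eq_bigr => e _; rewrite mem_exponents.
case: (boolP (size e == n)) => //= /eqP se; case: (all _ e) => //=.
rewrite fits_rcons ?se ?sl // -andbA; case: (fits l e) => //=.
rewrite /f; case: leqP => er; last by rewrite andbF scaler0.
rewrite andbT scalerA -subzn //; case: ifPn => // /norP[l0 le].
(* Row n - 1 has become negative; the vanishing of W there supplies the bound by the appended 0 in
   [fits]. *)
rewrite (@Wn_neg _ _ n.-1) ?scaler0 //; [lia|lia|].
rewrite /embed nth_rcons size_lowered ?se ?sl // ifT; last by rewrite -sl; case: l l0 {lN srt f sl le}.
by move: le; rewrite nth_lowered ?se ?sl // -!nth_last se sl -ltNge subr0 subr_lt0.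
Qed.

(** The row receiving the boxes left over comes first after reversal and starts from 0; its
    coefficient 1 is [strip_coef 0]. *)
Lemma Wn_Vn_sum N n l (b : nat) : size l = n -> sorted >=%R l -> all (fun z => 0 <= z) l ->
  wsum n.+1 (embed (rcons l b%:Z)) < N%:Z -> (b < N)%N ->
  Wn n (embed (rcons l b%:Z)) =
  \sum_(e <- exponents N n.+1 | fits (0 :: negrev l) e && (sumn e == b))
     strip_weight tq 0 (0 :: negrev l) e *: Vn n.+1 (embed (negrev (lowered (0 :: negrev l) e))).
Proof.
move=> sl srt l0 lN bN.
have Vv : wvanish n.+1 (Vn n.+1).
  by apply: op_wvanish; [exact: inside_pairs | exact: base_wvanish].
have ir : all (inside n.+1) (rlastops n).
  by rewrite (perm_all _ (perm_rlastops n)) inside_lastops.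
rewrite Wn_Vn (@op_opN _ _ _ _ N) // opN_raise_exponents //.
pose f (l' : seq int) a : M := if a == b then Vn n.+1 (embed (negrev l')) else 0.
set mu := 0 :: negrev l; have smu : size mu = n.+1 by rewrite /= size_negrev sl.
transitivity (\sum_(e <- exponents N (size mu)) free_weight tq 0 e *: f (lowered mu e) (sumn e)).
  (* Given the other exponents, the total leaves p = b - |e| as the only possible exponent of the
     added row. *)
  rewrite smu big_exponentsS exchange_big /= big_seq [RHS]big_seq.
  apply: eq_bigr => e; rewrite mem_exponents => /andP[/eqP se _].
  transitivity (\sum_(0 <= p < N) if p == (b - sumn e)%N then free_weight tq tq e *: Vn n.+1
     (embed (rcons (negrev (lowered (negrev l) e)) (b%:Z - (sumn e)%:Z))) else 0).
    by rewrite -big_mkcond big_nat1_eq /= ifT //; lia.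
  apply: eq_big_nat => p pN.
  have cw0 : strip_coef 0 p = 1 :> K by case: (p) => //= ?; rewrite subr0.
  rewrite cw0 mul1r /f /=; case: (leqP (sumn e) b) => eb.
    rewrite (_ : (p + sumn e == b) = (p == b - sumn e)%N); last by apply/eqP/eqP; lia.
    case: eqP => [pE|]; rewrite ?scaler0 //; congr (_ *: Vn _ (embed _)).
    by rewrite /negrev /= rev_cons; congr rcons; rewrite pE; lia.
  rewrite (_ : (p + sumn e == b)%N = false) ?scaler0; last by apply/negbTE; lia.
  (* For |e| > b the natural difference is truncated to 0, while the integer in the last row is
     negative and V vanishes. *)
  case: eqP => // _; rewrite Vn_neg ?scaler0 //.
  by rewrite /embed nth_rcons size_negrev size_lowered ?se size_negrev ?sl // ltnn eqxx; lia.
have smuS : sorted >=%R mu.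
  rewrite /= path_sortedE; last exact: rev_trans le_trans.
  apply/andP; split; first by rewrite all_rev all_map; apply: sub_all l0 => z /=; rewrite oppr_le0.
  by rewrite rev_sorted sorted_map; apply: sub_sorted srt => x y /=; rewrite lerN2.
rewrite strip_sum //; first last.
- by move=> l' a Na; rewrite /f ifF //; apply/negbTE; lia.
- rewrite smu => a l1 l2 m d sz d0; rewrite /f; case: eqP => _; last first.
    by rewrite big1 ?scaler0 // => u _; rewrite scaler0.
  exact: (Vn_straightens 0).
rewrite smu [RHS]big_mkcondr; apply: eq_bigr => e _.
by rewrite /f; case: ifP; rewrite ?scaler0.
Qed.

End Vertex.

(** * Expansion of the defining sum *)

Lemma raisingE p (alpha : intvec) i : (p.1 < p.2)%N ->
  raising p alpha i = alpha i + opvec ((false, false), p) i.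
Proof.
move=> p12; rewrite /raising !fsfun_withE /opvec /=.
case: (eqVneq i p.1) => [->|_]; first by rewrite (ltn_eqF p12) subr0.
by case: (eqVneq i p.2) => [->|_] /=; lia.
Qed.

Lemma loweringE p (alpha : intvec) i : (p.1 < p.2)%N ->
  lowering p alpha i = alpha i + opvec ((true, false), p) i.
Proof.
move=> p12; rewrite /lowering !fsfun_withE /opvec /=.
case: (eqVneq i p.1) => [->|_]; first by rewrite (ltn_eqF p12) subr0.
by case: (eqVneq i p.2) => [->|_] /=; lia.
Qed.

Lemma opmonomE (step : nat * nat -> intvec -> intvec) (l : bool) (e : opexp)
    (alpha : intvec) (i : nat) :
  (forall p (beta : intvec) k, (p.1 < p.2)%N ->
     step p beta k = beta k + opvec ((l, false), p) k) ->
  on_increasing_pairs e ->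
  opmonom step e alpha i =
  alpha i + \sum_(p <- finsupp e) opvec ((l, false), p) i * (e p)%:Z.
Proof.
move=> opE he; rewrite /opmonom.
elim: {-2}(finsupp e : seq _) (fun p (h : p \in (finsupp e : seq _)) => h) => [|p s IH] sub.
  by rewrite big_nil addr0.
rewrite big_cons /= addrCA -IH; last by move=> q qs; apply: sub; rewrite inE qs orbT.
have p12 : (p.1 < p.2)%N by apply: he; apply: sub; rewrite inE eqxx.
elim: (e p) => [|k IHk]; first by rewrite mulr0 add0r.
by rewrite iterS opE // IHk -addn1 PoszD mulrDr mulr1 addrAC.
Qed.

Section Expansion.
Variables (K : comNzRingType) (M : comAlgType K) (tq theta : K) (rc : nat -> K).
Variable v : int -> M.
Hypothesis rc0 : rc 0 = 1.
Hypothesis v0 : v 0 = 1.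
Hypothesis v_neg : forall k : int, k < 0 -> v k = 0.

Let vs (beta : intvec) : M := \prod_(i <- finsupp beta) v (beta i).

Lemma big_finsupp (I : choiceType) (V : eqType) (z : V) (l : {fsfun I -> V with z})
    (P : seq I) (R : Type) (idx : R) (opr : Monoid.com_law idx) (G : I -> R) :
  uniq P -> {subset finsupp l <= P} -> (forall p, l p = z -> G p = idx) ->
  \big[opr/idx]_(p <- finsupp l) G p = \big[opr/idx]_(p <- P) G p.
Proof.
move=> uP lP G0.
rewrite [RHS](bigID (mem (finsupp l))) /= [X in opr _ X]big1 ?Monoid.mulm1; last first.
  by move=> p pl; apply: G0; apply: fsfun_dflt.
rewrite -[RHS]big_filter; apply: perm_big; apply: uniq_perm.
- exact: fset_uniq.
- exact: filter_uniq.
- by move=> p; rewrite mem_filter; case: (boolP (p \in finsupp l)) => [/lP|].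
Qed.

Lemma vs_base n (beta : intvec) : (forall i, (n <= i)%N -> beta i = 0) ->
  vs beta = base v n beta.
Proof.
move=> bn; rewrite /vs /base (big_finsupp (P := iota 0 n)) ?iota_uniq //.
- by rewrite -(big_mkord predT (fun i => v (beta i))) /index_iota subn0.
- move=> i; rewrite mem_finsupp mem_iota; apply: contraR.
  by rewrite -leqNgt => /bn ->.
- by move=> i ->.
Qed.

Lemma vs_neg (beta : intvec) i : beta i < 0 -> vs beta = 0.
Proof.
move=> bi; rewrite /vs (big_rem i) /=; first by rewrite v_neg // mul0r.
by rewrite mem_finsupp; apply/eqP => b0; rewrite b0 in bi.
Qed.

Definition wdot (w : nat -> nat) B (alpha : nat -> int) : int :=
  \sum_(0 <= i < B) (w i)%:Z * alpha i.

Lemma wdot_opvec w B (l c : bool) p : (p.1 < p.2 < B)%N ->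
  wdot w B (opvec ((l, c), p)) = (if l then - (w p.1)%:Z else (w p.1)%:Z) - (w p.2)%:Z.
Proof.
case/andP=> p12 p2B.
have D k : (k < B)%N -> \sum_(0 <= i < B) (w i)%:Z * (i == k)%:Z = (w k)%:Z.
  move=> kB; under eq_bigr do rewrite mulrC eq_sym.
  by rewrite (sum_delta B k (fun i => (w i)%:Z)) kB.
rewrite /wdot /opvec /=; under eq_bigr do rewrite mulrBr.
rewrite sumrB D //; case: l; last by rewrite D //; lia.
by under eq_bigr do rewrite mulrN; rewrite sumrN D //; lia.
Qed.

(* [w i = i + 1] will bound the exponents, and [w i = (i + 1 - n)] (truncated) will
   confine the pairs to the rows below [n]. *)
Lemma exponent_bound w B (alpha : intvec) (l m : opexp) (beta : nat -> int) :
  {homo w : i j / (i <= j)%N} ->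
  on_increasing_pairs l -> on_increasing_pairs m ->
  (forall p, p \in finsupp l -> (p.2 < B)%N) -> (forall p, p \in finsupp m -> (p.2 < B)%N) ->
  (forall i, beta i = alpha i + \sum_(p <- finsupp m) opvec ((false, false), p) i * (m p)%:Z
                      + \sum_(p <- finsupp l) opvec ((true, false), p) i * (l p)%:Z) ->
  (forall i, 0 <= beta i) ->
  (forall p, p \in finsupp l -> ((w p.1 + w p.2)%:Z * (l p)%:Z <= wdot w B alpha)) /\
  (forall p, p \in finsupp m -> ((w p.2 - w p.1)%N%:Z * (m p)%:Z <= wdot w B alpha)).
Proof.
move=> wm hl hm lB mB bE b0.
have S (e : opexp) (c : bool) : on_increasing_pairs e ->
    (forall p, p \in finsupp e -> (p.2 < B)%N) ->
    wdot w B (fun i => \sum_(p <- finsupp e) opvec ((c, false), p) i * (e p)%:Z) =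
    - \sum_(p <- finsupp e) (if c then (w p.1 + w p.2)%N else (w p.2 - w p.1)%N)%:Z * (e p)%:Z.
  move=> he eB; rewrite /wdot; under eq_bigr do rewrite mulr_sumr.
  rewrite exchange_big /= -sumrN big_seq [RHS]big_seq; apply: eq_bigr => p pe.
  under eq_bigr do rewrite mulrA.
  rewrite -mulr_suml -[X in X * _]/(wdot w B _) wdot_opvec; last first.
    by rewrite he // eB.
  have := wm p.1 p.2 (ltnW (he _ pe)).
  case: (c); rewrite -mulNr => ?; congr (_ * _).
    by rewrite PoszD opprD.
  by rewrite -subzn // opprB.
have wb : 0 <= wdot w B beta by apply: sumr_ge0 => i _; apply: mulr_ge0.
have wE : wdot w B beta = wdot w B alpha
   - (\sum_(p <- finsupp m) (w p.2 - w p.1)%N%:Z * (m p)%:Z)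
   - (\sum_(p <- finsupp l) (w p.1 + w p.2)%N%:Z * (l p)%:Z).
  rewrite -(S m false) // -(S l true) // /wdot -!big_split /=.
  by apply: eq_bigr => i _; rewrite bE !mulrDr.
have pos (e : opexp) (g : nat * nat -> nat) p : p \in finsupp e ->
    (g p)%:Z * (e p)%:Z <= \sum_(q <- finsupp e) (g q)%:Z * (e q)%:Z.
  move=> pe; rewrite (big_rem p) //= lerDl sumr_ge0 // => q _; exact: mulr_ge0.
have pos0 (e : opexp) (g : nat * nat -> nat) :
    0 <= \sum_(q <- finsupp e) (g q)%:Z * (e q)%:Z.
  by apply: sumr_ge0 => q _; apply: mulr_ge0.
have Pl := pos0 l (fun p => w p.1 + w p.2)%N; have Pm := pos0 m (fun p => w p.2 - w p.1)%N.
have E : wdot w B alpha = wdot w B beta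
   + (\sum_(p <- finsupp l) (w p.1 + w p.2)%N%:Z * (l p)%:Z)
   + (\sum_(p <- finsupp m) (w p.2 - w p.1)%N%:Z * (m p)%:Z).
  by rewrite wE !subrK.
split=> p pe; rewrite E.
  apply: (le_trans (pos l (fun p => w p.1 + w p.2)%N p pe)).
  by rewrite addrAC lerDr addr_ge0.
apply: (le_trans (pos m (fun p => w p.2 - w p.1)%N p pe)).
by rewrite lerDr addr_ge0.
Qed.

Section Expand.
Variables (n N : nat) (alpha : intvec).
Hypothesis alphan : forall i, (n <= i)%N -> alpha i = 0.
Hypothesis alphaN : wsum n alpha < N%:Z.
Hypothesis N_gt0 : (0 < N)%N.

Let P := incpairs n.

Definition mkexp (e : seq nat) : opexp :=
  [fsfun p in [fset p | p in P]%fset => nth 0%N e (index p P)].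

Lemma mkexpE e p : mkexp e p = if p \in P then nth 0%N e (index p P) else 0%N.
Proof. by rewrite fsfun_fun in_fset /=. Qed.

Lemma mkexp_map e : size e = size P -> [seq mkexp e p | p <- P] = e.
Proof.
move=> se; apply: (@eq_from_nth _ 0%N); rewrite size_map // => i iP.
rewrite (nth_map (0, 0)%N) // mkexpE mem_nth //.
by rewrite index_uniq // incpairs_uniq.
Qed.

Lemma map_mkexp (l : opexp) : {subset finsupp l <= P} -> mkexp [seq l p | p <- P] = l.
Proof.
move=> lP; apply/fsfunP => p; rewrite mkexpE; case: ifP => [pP|/negbT pP].
  by rewrite (nth_map (0, 0)%N) ?index_mem // nth_index.
by rewrite fsfun_dflt //; apply: contra pP => /lP.
Qed.

Lemma mkexp_sub e : {subset finsupp (mkexp e) <= P}.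
Proof. by move=> p; rewrite mem_finsupp mkexpE; case: ifP. Qed.

Lemma mkexp_incr e : on_increasing_pairs (mkexp e).
Proof. by move=> p /mkexp_sub; rewrite mem_incpairs => /andP[]. Qed.

Definition term (lm : opexp * opexp) : M :=
  ((\prod_(p <- finsupp lm.1) (rc (lm.1 p) * theta ^+ lm.1 p)) *
   (\prod_(p <- finsupp lm.2) rc (lm.2 p))) *:
    vs (opmonom lowering lm.1 (opmonom raising lm.2 alpha)).

Definition incexps (lm : opexp * opexp) : Prop :=
  on_increasing_pairs lm.1 /\ on_increasing_pairs lm.2.

Lemma opmonoms_lm l m i : on_increasing_pairs l -> on_increasing_pairs m ->
  opmonom lowering l (opmonom raising m alpha) i =
  alpha i + \sum_(p <- finsupp m) opvec ((false, false), p) i * (m p)%:Z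
          + \sum_(p <- finsupp l) opvec ((true, false), p) i * (l p)%:Z.
Proof.
move=> hl hm; rewrite (opmonomE (l := true)) //; last by move=> *; exact: loweringE.
by rewrite (opmonomE (l := false)) //; move=> *; exact: raisingE.
Qed.

Definition exppairs : seq (opexp * opexp) :=
  [seq (mkexp e1, mkexp e2) | e1 <- exponents N (size P), e2 <- exponents N (size P)].

Lemma exppairs_uniq : uniq exppairs.
Proof.
apply: allpairs_uniq; try exact: exponents_uniq.
move=> [a b] [c d] /allpairsP[[a' b'] [+ + [-> ->]]] /allpairsP[[c' d'] [+ + [-> ->]]] /=.
rewrite !mem_exponents => /andP[/eqP sa _] /andP[/eqP sb _] /andP[/eqP sc _] /andP[/eqP sd _].
move=> [/(congr1 (fun l : opexp => [seq l p | p <- P])) + /(congr1 (fun l : opexp => [seq l p | p <- P]))].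
by rewrite !mkexp_map // => -> ->.
Qed.

(** A nonzero term has no negative entry, so [exponent_bound] applies to its exponents. *)
Lemma term_out lm : incexps lm -> lm \notin exppairs -> term lm = 0.
Proof.
case: lm => l m [/= hl hm]; apply: contraNeq => t0.
pose beta := opmonom lowering l (opmonom raising m alpha).
have b0 i : 0 <= beta i.
  rewrite leNgt; apply/negP => /vs_neg bi; move: t0.
  by rewrite /term /= -/beta bi scaler0 eqxx.
have bE i : beta i = _ := opmonoms_lm i hl hm.
pose B := (n + \max_(p <- finsupp l) p.2.+1 + \max_(p <- finsupp m) p.2.+1)%N.
have lB p : p \in finsupp l -> (p.2 < B)%N.
  move=> pl; have := @leq_bigmax_seq _ _ xpredT (fun p => p.2.+1) p pl isT; rewrite /B /=; lia.
have mB p : p \in finsupp m -> (p.2 < B)%N.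
  move=> pl; have := @leq_bigmax_seq _ _ xpredT (fun p => p.2.+1) p pl isT; rewrite /B /=; lia.
have H w wm := @exponent_bound w B alpha l m beta wm hl hm lB mB bE b0.
(* For this weight alpha has value 0, while a pair reaching row n or beyond has a positive cost, so
   its exponent must be 0. *)
have [|l1 m1] := H (fun i => i.+1 - n)%N; first by move=> i j; lia.
have z0 : wdot (fun i => i.+1 - n)%N B alpha = 0.
  rewrite /wdot big1 // => i _; case: (leqP n i) => ni; first by rewrite alphan ?mulr0.
  by rewrite (_ : i.+1 - n = 0)%N ?mul0r //; lia.
have [|l2 m2] := H (fun i => i.+1)%N; first by move=> i j; lia.
have zw : wdot (fun i => i.+1)%N B alpha = wsum n alpha.
  rewrite /wdot (@big_cat_nat _ _ _ n) //=; last by rewrite /B; lia.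
  rewrite [X in _ + X]big1_seq ?addr0; first by rewrite big_mkord.
  by move=> i; rewrite mem_index_iota => /andP[_ /andP[ni _]]; rewrite alphan ?mulr0.
have ge1 (x y : nat) (z : int) : x%:Z * y%:Z <= z -> (0 < x)%N -> y%:Z <= z by nia.
have sub1 (a b : nat) : (a < b)%N -> (n <= b)%N -> (0 < b.+1 - n - (a.+1 - n))%N by lia.
have sub2 (a b : nat) : (a < b)%N -> (0 < b.+1 - a.+1)%N by lia.
have add1 (a b : nat) : (n <= b)%N -> (0 < a + (b.+1 - n))%N by lia.
have ltN (x : nat) : x%:Z <= wsum n alpha -> (x < N)%N by lia.
have lP : {subset finsupp l <= P}.
  move=> p pl; rewrite mem_incpairs hl //= ltnNge; apply/negP => np.
  have := ge1 _ _ _ (l1 p pl) (add1 _ _ np); move: pl.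
  by rewrite z0 mem_finsupp -leqn0 -lez_nat => /negbTE->.
have mP : {subset finsupp m <= P}.
  move=> p pm; rewrite mem_incpairs hm //= ltnNge; apply/negP => np.
  have := ge1 _ _ _ (m1 p pm) (sub1 _ _ (hm p pm) np); move: pm.
  by rewrite z0 mem_finsupp -leqn0 -lez_nat => /negbTE->.
have lN p : (l p < N)%N.
  case: (finsuppP l p) => // pl; apply: ltN; rewrite -zw.
  exact: (ge1 _ _ _ (l2 p pl)).
have mN p : (m p < N)%N.
  case: (finsuppP m p) => // pm; apply: ltN; rewrite -zw.
  exact: (ge1 _ _ _ (m2 p pm) (sub2 _ _ (hm p pm))).
apply/allpairsP; exists ([seq l p | p <- P], [seq m p | p <- P]) => /=.
rewrite !mem_exponents !size_map !eqxx /= !all_map; split; last by rewrite !map_mkexp.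
  by apply/allP => p _ /=.
by apply/allP => p _ /=.
Qed.

Lemma sum_term :
  \sum_(lm \in [set lm : opexp * opexp | incexps lm]) term lm =
  opN (opcoef tq theta rc) N (pairs n) (base v n) alpha.
Proof.
rewrite (fsbigE exppairs) ?exppairs_uniq //; first last.
- exact: term_out.
- by move=> _ /= /allpairsP[[e1 e2] [_ _ ->]]; split; apply: mkexp_incr.
rewrite big_mkcond /exppairs big_allpairs_dep /=.
rewrite opN_cat opN_exponents size_map big_seq [RHS]big_seq; apply: eq_bigr => e1.
rewrite mem_exponents => /andP[/eqP s1 _].
rewrite opN_exponents size_map scaler_sumr big_seq [RHS]big_seq; apply: eq_bigr => e2.
rewrite mem_exponents => /andP[/eqP s2 _].
rewrite mem_set; last by split; apply: mkexp_incr.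
rewrite scalerA /term /=.
have Z (c : bool) e (R : Type) (idx : R) (opr : Monoid.com_law idx) (G : opidx -> nat -> R) :
    size e = size P -> (forall o, G o 0%N = idx) ->
    \big[opr/idx]_(p <- zip [seq ((c, false), p) | p <- P] e) G p.1 p.2 =
    \big[opr/idx]_(p <- finsupp (mkexp e)) G ((c, false), p) (mkexp e p).
  move=> se G0; rewrite (big_finsupp (P := P)) ?incpairs_uniq //.
  - rewrite -{1}(mkexp_map se) zip_map big_map //.
  - exact: mkexp_sub.
  - by move=> p ->.
have c0 o : opcoef tq theta rc o 0 = 1 by rewrite /opcoef rc0; case: ifP; case: ifP; rewrite mulr1.
rewrite !(Z _ _ _ _ _ (opcoef tq theta rc)) //.
congr (_ * _ *: _).
- by apply: eq_bigr => p _; rewrite /opcoef /= mulr1.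
rewrite (@vs_base n).
  congr base; apply: funext => i.
  by rewrite opmonoms_lm ?(Z _ _ _ _ _ (fun o s => opvec o i * s%:Z)) //; try exact: mkexp_incr;
    [rewrite addrAC | move=> o; rewrite mulr0 | move=> o; rewrite mulr0].
move=> i ni; rewrite opmonoms_lm; try exact: mkexp_incr.
rewrite alphan // !big1_seq ?addr0 // => p /= /mkexp_sub;
  rewrite mem_incpairs => /andP[p12 p2n];
  have i2 := leq_trans p2n ni; have i1 := ltn_trans p12 i2;
  by rewrite /opvec /= (gtn_eqF i1) (gtn_eqF i2) mul0r.
Qed.
End Expand.

End Expansion.

(** * Horizontal strips *)

Section State.
Variables (K : comNzRingType) (t : K).

Fixpoint state (x : K) (a : nat -> int) (e : nat -> nat) i : K :=
  if i is j.+1 then next_state t (state x a e j) `|a j - a j.+1|%N (e j) else x.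

Lemma strip_weight_state x (mu : seq int) e : size e = size mu ->
  strip_weight t x mu e =
  \prod_(0 <= i < size mu) strip_coef (state x (nth 0 mu) (nth 0%N e) i) (nth 0%N e i).
Proof.
elim: mu x e => [|m mu IH] x [|s e] //=; first by rewrite big_geq.
case=> se; rewrite big_nat_recl //= IH //; congr (_ * _).
apply: eq_big_nat => i imu; congr strip_coef.
have {imu se} : (0 < size mu)%N by lia.
case: mu {IH} => // m' mu _.
by elim: i => //= i ->.
Qed.

Lemma antitone_le (a : nat -> int) n : (forall i, (i.+1 < n)%N -> a i.+1 <= a i) ->
  forall i j, (i <= j < n)%N -> a j <= a i.
Proof.
move=> H i; elim=> [|j IH] /andP[ij jn]; first by move: ij; rewrite leqn0 => /eqP->.
move: ij; rewrite leq_eqVlt => /predU1P[->//|ij].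
by apply: le_trans (H j jn) (IH _); lia.
Qed.

(** Within a block of equal rows each new row multiplies the state by t. A block starts at t, the
    first one at x, and at 0 when the last row of the previous block has come down to it. *)
Lemma stateE x a e n i :
  (forall j, (j.+1 < n)%N -> a j.+1 <= a j - (e j)%:Z) -> (i < n)%N ->
  state x a e i =
  if has (fun j => (a j - (e j)%:Z == a i) && (a i < a j)) (iota 0 i) then 0 else
  if a i == a 0%N then x * t ^+ count (fun j => a j == a i) (iota 0 i)
  else t ^+ (count (fun j => a j == a i) (iota 0 i)).+1.
Proof.
move=> H; have am : forall j k, (j <= k < n)%N -> a k <= a j.
  by apply: antitone_le => j /H; lia.
elim: i => [|i IH] i_n; first by rewrite /= eqxx mulr1.
have -> : iota 0 i.+1 = iota 0 i ++ [:: i] by rewrite -addn1 iotaD add0n.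
rewrite has_cat count_cat /= orbF addn0 IH; last lia.
have := H i i_n; rewrite /next_state.
have [aE|aN] := eqVneq (a i.+1) (a i) => Hi.
  rewrite aE subrr /= ltxx andbF orbF ?eqxx ?addn1.
  by case: ifP => _; rewrite ?mul0r //; case: ifP => _; rewrite !exprSr ?mulrA.
have ai : a i.+1 < a i by lia.
rewrite [LHS]ifF; last by apply/negbTE; lia.
(* A row j < i stays at or above row j + 1, hence above the new value; only row i can come down to
   it. *)
rewrite [has _ _](_ : _ = false); last first.
  apply/hasPn => j; rewrite mem_iota => /andP[_ ji].
  have H1 : a j.+1 <= a j - (e j)%:Z by apply: H; lia.
  have H2 : a i <= a j.+1 by apply: am; lia.
  by apply/negP => /andP[/eqP E _]; move: H1; rewrite E leNgt (lt_le_trans ai H2).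
rewrite [count _ _](_ : _ = 0%N); last first.
  apply/eqP; rewrite -leqn0 leqNgt -has_count; apply/hasPn => j; rewrite mem_iota => ji.
  have H2 : a i <= a j by apply: am; lia.
  by rewrite gt_eqF // (lt_le_trans ai H2).
rewrite /= ai andbT (_ : (e i == _)%N = (a i - (e i)%:Z == a i.+1)); last by apply/eqP/eqP; lia.
case: ifP => // _; rewrite expr1 ifF //.
have H2 : a i <= a 0%N by apply: am; lia.
by rewrite lt_eqF // (lt_le_trans ai H2).
Qed.
End State.

(** * Horizontal strips as interlacing pairs; phi and psi as products over rows *)

Section Partitions.
Implicit Types (lam mu nu : intpart).

Lemma part_sorted lam : sorted geq lam.
Proof. by case: lam => l /= /andP[]. Qed.

Lemma part_gt0 lam i : (i < size lam)%N -> (0 < nth 0%N lam i)%N.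
Proof.
case: lam => l /= /andP[_ l0] il; rewrite lt0n; apply: contra l0 => /eqP <-.
exact: mem_nth.
Qed.

Lemma part_anti lam i j : (i <= j)%N -> (nth 0 lam j <= nth 0 lam i)%N.
Proof.
move=> ij; case: (ltnP j (size lam)) => jl; last by rewrite (nth_default _ jl).
apply: (sorted_leq_nth _ _ _ (part_sorted lam)) => //.
- exact: rev_trans leq_trans.
- by move=> x /=.
- by rewrite inE (leq_ltn_trans ij).
Qed.

Lemma part_ext lam mu : (forall i, nth 0 lam i = nth 0 mu i)%N -> lam = mu.
Proof.
move=> E; apply: val_inj => /=; apply: (@eq_from_nth _ 0%N) => //.
have H (l m : intpart) : (forall i, nth 0 l i = nth 0 m i)%N -> (size l <= size m)%N.
  move=> lm; rewrite leqNgt; apply/negP => /part_gt0.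
  by rewrite lm nth_default.
by apply/eqP; rewrite eqn_leq !H.
Qed.

Lemma mkpart_proof (l : seq nat) : is_partition [seq x <- sort geq l | 0 < x]%N.
Proof.
rewrite /is_partition mem_filter /= andbT sorted_filter //.
  exact: rev_trans leq_trans.
by apply: sort_sorted => x y; apply: leq_total.
Qed.

(** Sorting makes the construction total; a decreasing list only loses its zeros. *)
Definition mkpart l : intpart := IntPart (mkpart_proof l).

Arguments mkpart : simpl never.

Lemma nth_mkpart (f : nat -> nat) n i :
  (forall j, (j.+1 < n)%N -> f j.+1 <= f j)%N ->
  nth 0%N (mkpart (mkseq f n)) i = if (i < n)%N then f i else 0%N.
Proof.
move=> fm; have gt : transitive geq by apply: rev_trans leq_trans.
have sf : sorted geq (mkseq f n).
  apply/(sortedP 0%N) => j; rewrite size_mkseq => jn; rewrite !nth_mkseq ?(ltnW jn) //.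
  exact: fm.
rewrite /mkpart /= sorted_sort //.
have -> : nth 0%N [seq x <- mkseq f n | 0 < x]%N i = nth 0%N (mkseq f n) i.
  elim: (mkseq f n) sf i => //= x s IH px i.
  have ps := path_sorted px; case: ifPn => x0; first by case: i => //= i; rewrite IH.
  have s0 : all (geq x) s by rewrite (order_path_min gt).
  have {}x0 : x = 0%N by lia.
  rewrite IH // {}x0 in s0 *; case: i => [|i] /=.
    by case: s s0 {IH px ps} => //= y s /andP[/= ]; rewrite leqn0 => /eqP.
  have z j : nth 0%N s j = 0%N.
    case: (ltnP j (size s)) => js; last by rewrite nth_default.
    by have := all_nthP 0%N s0 j js; rewrite /= leqn0 => /eqP.
  by rewrite !z.
case: ltnP => i_n; first by rewrite nth_mkseq.
by rewrite nth_default // size_mkseq.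
Qed.

Lemma size_part_le lam n : (forall i, (n <= i)%N -> nth 0 lam i = 0)%N -> (size lam <= n)%N.
Proof. by move=> H; rewrite leqNgt; apply/negP => /part_gt0; rewrite H. Qed.

Lemma sumn_part lam n : (size lam <= n)%N -> sumn lam = (\sum_(0 <= i < n) nth 0 lam i)%N.
Proof.
move=> ln; rewrite sumnE (big_nth 0%N) [RHS](@big_cat_nat _ _ _ (size lam)) //=.
rewrite [X in (_ + X)%N]big1_seq ?addn0 // => i; rewrite mem_index_iota => /andP[_ /andP[il _]].
by rewrite nth_default.
Qed.

Lemma count_part (p : pred nat) lam n : ~~ p 0%N -> (size lam <= n)%N ->
  count p lam = (\sum_(0 <= i < n) p (nth 0 lam i))%N.
Proof.
move=> p0 ln; rewrite -sum1_count big_mkcond (big_nth 0%N) [RHS](@big_cat_nat _ _ _ (size lam)) //=.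
rewrite [X in (_ + X)%N]big1_seq ?addn0.
  by apply: eq_bigr => i _; case: (p _).
move=> i; rewrite mem_index_iota => /andP[_ /andP[il _]].
by rewrite nth_default // (negbTE p0).
Qed.

(* rows are numbered from 0 and columns from 1 *)
Definition box nu mu c i : bool := (nth 0 nu i < c <= nth 0 mu i)%N.

Lemma column_sizeE nu mu n c : (0 < c)%N -> part_le nu mu -> (size mu <= n)%N ->
  column_size nu mu c = (\sum_(0 <= i < n) box nu mu c i)%N.
Proof.
move=> c0 le mn; have nn : (size nu <= n)%N.
  apply: leq_trans mn; apply: size_part_le => i mi.
  by have := le i; rewrite (nth_default _ mi); lia.
rewrite /column_size /conj_part !(@count_part _ _ n) ?leqn0 -?lt0n //.
rewrite -sumnB; last by move=> i _; have := le i; lia.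
apply: eq_bigr => i _; rewrite /box; have := le i; lia.
Qed.

Definition interlace nu mu : Prop :=
  forall i, (nth 0 nu i <= nth 0 mu i)%N /\ (nth 0 mu i.+1 <= nth 0 nu i)%N.

(** For rows i < j, c <= mu_j <= mu_(i+1) <= nu_i < c would follow. *)
Lemma box_uniq nu mu c i j : interlace nu mu -> box nu mu c i -> box nu mu c j -> i = j.
Proof.
move=> il; wlog ij : i j / (i <= j)%N.
  by move=> H bi bj; case: (leqP i j) => ?; [|apply/esym]; apply: H => //; lia.
rewrite /box => bi bj; apply/eqP; rewrite eqn_leq ij /= leqNgt; apply/negP => lt.
have [_ H] := il i; have := part_anti mu lt; lia.
Qed.

Lemma column_size_box nu mu n c i : (0 < c)%N -> interlace nu mu -> (size mu <= n)%N ->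
  box nu mu c i -> column_size nu mu c = 1%N.
Proof.
move=> c0 il mn bi; rewrite (@column_sizeE _ _ n) //; last by move=> j; case: (il j).
have i_n : (i < n)%N.
  rewrite ltnNge; apply/negP => ni; move: bi; rewrite /box [nth 0 mu i]nth_default; first lia.
  exact: leq_trans mn ni.
rewrite (bigD1_seq i) ?mem_index_iota ?iota_uniq //= bi big1 // => j ji.
by case: (boolP (box nu mu c j)) => // bj; rewrite (box_uniq il bi bj) eqxx in ji.
Qed.

Lemma column_size_nobox nu mu c : (0 < c)%N -> interlace nu mu ->
  (forall i, ~~ box nu mu c i) -> column_size nu mu c = 0%N.
Proof.
move=> c0 il nb; rewrite (@column_sizeE _ _ (size mu)) //; last by move=> j; case: (il j).
by rewrite big1 // => i _; rewrite (negbTE (nb i)).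
Qed.

Definition hasbox nu mu n c : bool := has (box nu mu c) (iota 0 n).

Lemma hasboxP nu mu n c : (size mu <= n)%N ->
  reflect (exists i, box nu mu c i) (hasbox nu mu n c).
Proof.
move=> mn; apply: (iffP hasP) => [[i _ bi]|[i bi]]; first by exists i.
exists i => //; rewrite mem_iota /= add0n ltnNge; apply/negP => ni; move: bi.
rewrite /box [nth 0 mu i]nth_default; first lia.
exact: leq_trans mn ni.
Qed.

Lemma column_size_has nu mu n c : (0 < c)%N -> interlace nu mu -> (size mu <= n)%N ->
  column_size nu mu c = hasbox nu mu n c.
Proof.
move=> c0 il mn; case: (hasboxP nu c mn) => [[i bi]|nb].
  exact: (column_size_box c0 il mn bi).
apply: column_size_nobox => // i; apply/negP => bi; apply: nb; by exists i.
Qed.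

Lemma hstripP a nu mu :
  hstrip a nu mu <-> interlace nu mu /\ sumn mu = (sumn nu + a)%N.
Proof.
split=> [[le sE cs]|[il sE]].
  split=> // i; split; first exact: le.
  rewrite leqNgt; apply/negP => lt.
  (* Column mu_(i+1) would contain boxes of both rows i and i + 1. *)
  have c0 : (0 < nth 0 mu i.+1)%N by lia.
  have := cs _ c0; rewrite (@column_sizeE _ _ (maxn (size mu) i.+2)) ?leq_maxl //.
  rewrite (@big_cat_nat _ _ _ i) //=; last by rewrite leq_max; lia.
  rewrite (@big_cat_nat _ _ _ i.+2 i) ?leq_maxr //=; last lia.
  rewrite big_nat_recr //= big_nat1 /box.
  have := le i; have := le i.+1; have := part_anti mu (leqnSn i); have := part_anti nu (leqnSn i).
  lia.
split=> // [i|i i0]; first by case: (il i).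
by rewrite (@column_size_has _ _ (size mu)) // leq_b1.
Qed.

(** Row i yields the element c = mu_i of [Iset]: its last box lies in column c and column c + 1 is
    empty. *)
Definition phi_cond nu mu n i : bool :=
  (nth 0 nu i < nth 0 mu i)%N && ~~ hasbox nu mu n (nth 0 mu i).+1.

Lemma phiE nu mu n : interlace nu mu -> (size mu <= n)%N ->
  phi mu nu = \prod_(0 <= i < n | phi_cond nu mu n i) (1 - t ^+ mult (nth 0%N mu i) mu).
Proof.
move=> il mn; rewrite /phi.
pose r := [seq nth 0%N mu i | i <- [seq i <- iota 0 n | phi_cond nu mu n i]].
have memr c : reflect (Iset mu nu c) (c \in r).
  apply: (iffP mapP) => [[i]|[c0 s1 s0]].
    rewrite mem_filter => /andP[/andP[lt nb] _ ->].
    have c0 : (0 < nth 0 mu i)%N by lia.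
    split=> //; rewrite (column_size_has _ il mn) //; last by rewrite (negbTE nb).
    by rewrite (introT (hasboxP nu (nth 0%N mu i) mn)) //; exists i; rewrite /box lt /=.
  move: s1; rewrite (column_size_has _ il mn) //; case: (hasboxP nu c mn) => // -[i bi] _.
  move: s0; rewrite (column_size_has _ il mn) //; case: (hasboxP nu c.+1 mn) => // nb _.
  have ci : c = nth 0%N mu i.
    apply/eqP; rewrite eqn_leq; move: (bi) => /andP[bc ci]; rewrite ci /= leqNgt.
    by apply/negP => lt; apply: nb; exists i; rewrite /box lt ltnW.
  exists i => //; rewrite mem_filter /phi_cond -ci mem_iota.
  rewrite (introN (hasboxP nu c.+1 mn)) // andbT; apply/andP; split.
    by move: bi; rewrite /box -ci => /andP[].
  rewrite /= add0n ltnNge; apply/negP => ni; move: c0.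
  by rewrite ci nth_default // (leq_trans mn).
have ur : uniq r.
  rewrite map_inj_in_uniq ?filter_uniq ?iota_uniq // => i j.
  rewrite !mem_filter => /andP[/andP[bi _] _] /andP[/andP[bj _] _] E.
  by apply: (box_uniq (c := nth 0%N mu i) il); rewrite /box ?bi ?E ?bj leqnn.
have -> : Iset mu nu = [set` r].
  by apply/seteqP; split=> c /memr.
by rewrite -fsbig_seq // big_map big_filter /index_iota subn0.
Qed.

(** Row i yields the element c = nu_i of [Jset]: its first box lies in column c + 1 and column c is
    empty. *)
Definition psi_cond nu lam n i : bool :=
  [&& (0 < nth 0 nu i)%N, (nth 0 nu i < nth 0 lam i)%N & ~~ hasbox nu lam n (nth 0 nu i)].

Lemma psiE nu lam n : interlace nu lam -> (size lam <= n)%N ->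
  psi lam nu = \prod_(0 <= i < n | psi_cond nu lam n i) (1 - t ^+ mult (nth 0%N nu i) nu).
Proof.
move=> il mn; rewrite /psi.
pose r := [seq nth 0%N nu i | i <- [seq i <- iota 0 n | psi_cond nu lam n i]].
have memr c : reflect (Jset lam nu c) (c \in r).
  apply: (iffP mapP) => [[i]|[c0 s0 s1]].
    rewrite mem_filter => /andP[/and3P[c0 lt nb] _ ->].
    split=> //; rewrite (column_size_has _ il mn) //; first by rewrite (negbTE nb).
    by rewrite (introT (hasboxP nu (nth 0%N nu i).+1 mn)) //; exists i; rewrite /box lt ltnSn.
  move: s1; rewrite (column_size_has _ il mn) //; case: (hasboxP nu c.+1 mn) => // -[i bi] _.
  move: s0; rewrite (column_size_has _ il mn) //; case: (hasboxP nu c mn) => // nb _.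
  have ci : c = nth 0%N nu i.
    apply/eqP; rewrite eqn_leq; move: (bi) => /andP[]; rewrite ltnS => -> lt; rewrite andbT leqNgt.
    by apply/negP => lt'; apply: nb; exists i; rewrite /box lt' ltnW.
  exists i => //; rewrite mem_filter /psi_cond -ci mem_iota c0.
  rewrite (introN (hasboxP nu c mn)) // andbT; apply/andP; split.
    by move: bi; rewrite /box => /andP[].
  rewrite /= add0n ltnNge; apply/negP => ni; move: bi.
  by rewrite /box [nth 0 lam i]nth_default ?ltn0 ?andbF // (leq_trans mn).
have ur : uniq r.
  rewrite map_inj_in_uniq ?filter_uniq ?iota_uniq // => i j.
  rewrite !mem_filter => /andP[/and3P[_ bi _] _] /andP[/and3P[_ bj _] _] E.
  by apply: (box_uniq (c := (nth 0%N nu i).+1) il); rewrite /box ?bi ?E ?bj ltnSn.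
have -> : Jset lam nu = [set` r].
  by apply/seteqP; split=> c /memr.
by rewrite -fsbig_seq // big_map big_filter /index_iota subn0.
Qed.

End Partitions.

(** * Bijections between fitting exponents and horizontal strips *)

Section Rows.
Implicit Types (lam mu nu : intpart) (e : seq nat).

Definition plist n lam : seq int := mkseq (fun i => (nth 0%N lam i)%:Z) n.

Definition rev_plist n nu : seq int := mkseq (fun i => - (nth 0%N nu (n - i))%:Z) n.+1.

Definition rowdiff n mu nu : seq nat := mkseq (fun i => nth 0 mu i - nth 0 nu i)%N n.

Definition revdiff n nu lam : seq nat :=
  mkseq (fun i => nth 0 lam (n - i) - nth 0 nu (n - i))%N n.+1.

Definition sub_part n mu e : intpart := mkpart (mkseq (fun i => nth 0 mu i - nth 0 e i)%N n).

(** [e] lists the rows from row n up to row 0, in the order of [rev_plist]. *)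
Definition add_part n nu e : intpart :=
  mkpart (mkseq (fun i => nth 0 nu i + nth 0 e (n - i))%N n.+1).

Lemma fitsP (mu : seq int) e : reflect
  (forall i, (i.+1 < size mu)%N -> (i < size e)%N ->
     (nth 0%N e i)%:Z <= nth 0 mu i - nth 0 mu i.+1)
  (fits mu e).
Proof.
elim: mu e => [|m1 [|m2 mu] IH] [|s e]; try by apply: ReflectT => -[].
apply: (iffP andP) => [[s12 /IH H] [|i] //= i1 i2|H]; first exact: H.
split; first exact: (H 0%N).
by apply/IH => i i1 i2; apply: (H i.+1).
Qed.

Lemma rcons_plist n mu : (size mu <= n)%N -> rcons (plist n mu) 0 = plist n.+1 mu.
Proof. by move=> mn; rewrite [RHS]/plist mkseqS nth_default. Qed.

Lemma negrev_plist n nu : (size nu <= n)%N -> 0 :: negrev (plist n nu) = rev_plist n nu.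
Proof.
have sz : size (0 :: negrev (plist n nu)) = n.+1 by rewrite /= size_negrev size_mkseq.
move=> nn; apply: (@eq_from_nth _ 0); rewrite sz ?size_mkseq // => -[|i] i_n; rewrite [RHS]nth_mkseq //.
  by rewrite subn0 (nth_default 0%N nn).
by rewrite [LHS]/= nth_negrev size_mkseq (ltnSE i_n : (i < n)%N) nth_mkseq //; lia.
Qed.

Lemma sumn_nat e n : size e = n -> sumn e = (\sum_(0 <= i < n) nth 0 e i)%N.
Proof. by move=> <-; rewrite sumnE (big_nth 0%N). Qed.

Lemma sub_partP N n mu e (nu := sub_part n mu e) :
  (size mu <= n)%N -> e \in exponents N n -> fits (plist n.+1 mu) e ->
  [/\ interlace nu mu, sumn mu = (sumn nu + sumn e)%N,
      rowdiff n mu nu = e & lowered (plist n mu) e = plist n nu].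
Proof.
move=> mn; rewrite mem_exponents => /andP[/eqP se _] /fitsP H.
have {}H i : (i < n)%N -> (nth 0 e i + nth 0 mu i.+1 <= nth 0 mu i)%N.
  move=> i_n; have := H i; rewrite size_mkseq se ltnS !nth_mkseq ?ltnS //; last exact: ltnW.
  by move=> /(_ i_n i_n); lia.
have m0 i : (n <= i)%N -> nth 0%N mu i = 0%N.
  by move=> ni; rewrite nth_default // (leq_trans mn).
have nE i : nth 0%N nu i = if (i < n)%N then (nth 0 mu i - nth 0 e i)%N else 0%N.
  rewrite /nu nth_mkpart // => j jn; have := H j (ltnW jn); have := H j.+1 jn; lia.
have nn : (size nu <= n)%N by apply: size_part_le => i ni; rewrite nE ifF //; lia.
split.
- move=> i; rewrite nE; case: ltnP => i_n; first by have := H i i_n; lia.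
  by rewrite !m0 // ltnW.
- rewrite (sumn_part mn) (sumn_part nn) (sumn_nat se) -big_split /=.
  by apply: eq_big_nat => i /andP[_ i_n]; rewrite nE i_n; have := H i i_n; lia.
- apply: (@eq_from_nth _ 0%N); rewrite size_mkseq ?se // => i i_n.
  by rewrite nth_mkseq // nE i_n; have := H i i_n; lia.
apply: (@eq_from_nth _ 0); rewrite size_lowered ?size_mkseq // => i i_n.
rewrite nth_lowered ?size_mkseq // !nth_mkseq // nE i_n; have := H i i_n; lia.
Qed.

Lemma rowdiffP N n mu nu a : (size mu <= n)%N -> hstrip a nu mu -> (a < N)%N ->
  [/\ rowdiff n mu nu \in exponents N n, fits (plist n.+1 mu) (rowdiff n mu nu),
      sumn (rowdiff n mu nu) = a & sub_part n mu (rowdiff n mu nu) = nu].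
Proof.
move=> mn /hstripP[il sE] aN.
have m0 i : (n <= i)%N -> nth 0%N mu i = 0%N.
  by move=> ni; rewrite nth_default // (leq_trans mn).
have nn : (size nu <= n)%N.
  by apply: size_part_le => i ni; have [] := il i; rewrite m0 //; lia.
have se : size (rowdiff n mu nu) = n by rewrite size_mkseq.
have sa : sumn (rowdiff n mu nu) = a.
  apply/eqP; rewrite -(eqn_add2l (sumn nu)) -sE (sumn_part mn) (sumn_part nn) (sumn_nat se) -big_split /=.
  by apply/eqP/eq_big_nat => i /andP[_ i_n]; rewrite nth_mkseq //=; have [] := il i; lia.
split=> //.
- rewrite mem_exponents se eqxx; apply/allP => x /(nthP 0%N)[i]; rewrite se => i_n <-.
  apply: leq_ltn_trans aN; rewrite -sa (sumn_nat se).
  by rewrite (bigD1_seq i) ?mem_index_iota ?iota_uniq //= leq_addr.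
- apply/fitsP => i; rewrite se size_mkseq ltnS => _ i_n.
  rewrite !nth_mkseq ?ltnS //; last exact: ltnW.
  have := il i; lia.
apply: part_ext => i; rewrite nth_mkpart.
  case: ltnP => i_n; first by rewrite nth_mkseq //; have := il i; lia.
  by have := il i; rewrite m0 //; lia.
move=> j jn; rewrite !nth_mkseq ?(ltnW jn) //; have := il j; have := il j.+1; lia.
Qed.

Lemma add_partP N n nu e (lam := add_part n nu e) :
  (size nu <= n)%N -> e \in exponents N n.+1 -> fits (rev_plist n nu) e ->
  [/\ interlace nu lam, sumn lam = (sumn nu + sumn e)%N, (size lam <= n.+1)%N,
      revdiff n nu lam = e & negrev (lowered (rev_plist n nu) e) = plist n.+1 lam].
Proof.
move=> nn; rewrite mem_exponents => /andP[/eqP se _] /fitsP H.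
have {}H k : (k < n)%N -> (nth 0 e (n - k.+1) + nth 0 nu k.+1 <= nth 0 nu k)%N.
  move=> kn; have i1 : (n - (n - k.+1) = k.+1)%N by lia.
  have i2 : (n - (n - k.+1).+1 = k)%N by lia.
  have iN : ((n - k.+1).+1 < n.+1)%N by lia.
  have := H (n - k.+1)%N; rewrite size_mkseq se !nth_mkseq ?(ltnW iN) // i1 i2.
  by move=> /(_ iN isT); lia.
have n0 i : (n <= i)%N -> nth 0%N nu i = 0%N.
  by move=> ni; rewrite nth_default // (leq_trans nn).
have lE i : nth 0%N lam i = if (i < n.+1)%N then (nth 0 nu i + nth 0 e (n - i))%N else 0%N.
  rewrite /lam nth_mkpart // => j jn; have := H j jn; lia.
have ln : (size lam <= n.+1)%N by apply: size_part_le => i ni; rewrite lE ifF //; lia.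
split=> //.
- move=> i; rewrite !lE; split.
    by case: ltnP => i_n; [lia | rewrite n0 // ltnW].
  by case: ltnP => // i_n; have := H i i_n; lia.
- rewrite (sumn_part ln) (sumn_part (leqW nn)) (sumn_nat se).
  rewrite [X in (_ + X)%N]big_nat_rev -big_split /=.
  by apply: eq_big_nat => i /andP[_ i_n]; rewrite lE i_n add0n subSS.
- apply: (@eq_from_nth _ 0%N); rewrite size_mkseq ?se // => i i_n.
  rewrite nth_mkseq // lE ifT; last lia.
  by rewrite subKn ?addKn.
have sl : size (lowered (rev_plist n nu) e) = n.+1 by rewrite size_lowered size_mkseq.
apply: (@eq_from_nth _ 0); rewrite size_negrev sl ?size_mkseq // => i i_n.
rewrite nth_negrev sl i_n nth_lowered ?size_mkseq // !nth_mkseq //; last lia.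
rewrite lE i_n subSS subKn //; lia.
Qed.

Lemma revdiffP N n nu lam b : (size nu <= n)%N -> hstrip b nu lam -> (b < N)%N ->
  [/\ revdiff n nu lam \in exponents N n.+1, fits (rev_plist n nu) (revdiff n nu lam),
      sumn (revdiff n nu lam) = b & add_part n nu (revdiff n nu lam) = lam].
Proof.
move=> nn /hstripP[il sE] bN.
have n0 i : (n <= i)%N -> nth 0%N nu i = 0%N.
  by move=> ni; rewrite nth_default // (leq_trans nn).
have ln : (size lam <= n.+1)%N.
  by apply: size_part_le => -[|i] // ni; have [_] := il i; rewrite n0 //; lia.
have se : size (revdiff n nu lam) = n.+1 by rewrite size_mkseq.
have sb : sumn (revdiff n nu lam) = b.
  apply/eqP; rewrite -(eqn_add2l (sumn nu)) -sE (sumn_part ln) (sumn_part (leqW nn)) (sumn_nat se).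
  rewrite [X in (_ + X)%N]big_nat_rev -big_split /=.
  apply/eqP/eq_big_nat => i /andP[_ i_n]; rewrite nth_mkseq add0n ?subSS ?subKn //; last lia.
  by have [] := il i; lia.
split=> //.
- rewrite mem_exponents se eqxx; apply/allP => x /(nthP 0%N)[i]; rewrite se => i_n <-.
  apply: leq_ltn_trans bN; rewrite -sb (sumn_nat se).
  by rewrite (bigD1_seq i) ?mem_index_iota ?iota_uniq //= leq_addr.
- apply/fitsP => i; rewrite se size_mkseq => i_n _.
  rewrite !nth_mkseq ?(ltnW i_n) //.
  have E : ((n - i.+1).+1 = n - i)%N by lia.
  have [_] := il (n - i.+1)%N; have [] := il (n - i)%N; rewrite E; lia.
apply: part_ext => i; rewrite nth_mkpart.
  case: ltnP => i_n; last by rewrite nth_default // (leq_trans ln).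
  by rewrite nth_mkseq ?subKn //; have := il i; lia.
move=> j jn; rewrite !nth_mkseq ?subKn ?(ltnW jn) //; try lia.
have := il j; have := il j.+1; lia.
Qed.

End Rows.

(** * Strip weights as the products phi and psi *)

Section Weights.
Variables (R : comNzRingType) (t : R).
Implicit Types (lam mu nu : intpart) (e : seq nat).

(** With x = t the first block behaves like all others, so a row that loses boxes contributes 1 -
    t^m or, in state 0, the factor 1. *)
Lemma strip_weight_phi_prod n mu nu : interlace nu mu -> (size mu <= n)%N ->
  strip_weight t t (plist n mu) (rowdiff n mu nu) =
  \prod_(0 <= i < n | phi_cond nu mu n i) (1 - t ^+ mult (nth 0%N mu i) mu).
Proof.
move=> il mn; rewrite strip_weight_state ?size_mkseq // [RHS]big_mkcond.
apply: eq_big_nat => i /= i_n; rewrite (@stateE _ _ _ _ _ n) //; last first.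
  move=> j jn; rewrite !nth_mkseq ?(ltnW jn) //; have := il j; lia.
have nm k : (k < n)%N -> nth 0 (plist n mu) k = (nth 0%N mu k)%:Z by move=> ?; rewrite nth_mkseq.
have ne k : (k < n)%N -> nth 0%N (rowdiff n mu nu) k = (nth 0 mu k - nth 0 nu k)%N.
  by move=> ?; rewrite nth_mkseq.
rewrite ne // -exprS if_same /phi_cond.
case: (posnP (nth 0 mu i - nth 0 nu i)%N) => [E|e0].
  by rewrite E (_ : (nth 0 nu i < nth 0 mu i)%N = false) //; lia.
rewrite (_ : nth 0 nu i < nth 0 mu i)%N /=; last lia.
rewrite -(prednK e0) [LHS]/=.
(* A longer row comes down to length mu_i exactly when it owns the box in column mu_i + 1. *)
have -> : has (fun j => (nth 0 (plist n mu) j - (nth 0%N (rowdiff n mu nu) j)%:Z == nth 0 (plist n mu) i)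
      && (nth 0 (plist n mu) i < nth 0 (plist n mu) j)) (iota 0 i) =
    hasbox nu mu n (nth 0 mu i).+1.
  apply/hasP/(hasboxP _ _ mn) => [[j]|[j bj]].
    rewrite mem_iota /= add0n => ji; have [le _] := il j.
    rewrite !nm ?ne ?(ltn_trans ji) // subzn ?leq_subr // subKn // eqz_nat ltz_nat.
    by move=> /andP[/eqP E lt]; exists j; rewrite /box E leqnn.
  move: bj; rewrite /box => /andP[b1 b2].
  have ji : (j < i)%N.
    by rewrite ltnNge; apply/negP => /(part_anti mu) ge; rewrite ltnNge ge in b2.
  exists j; first by rewrite mem_iota.
  have [le _] := il j.
  rewrite !nm ?ne ?(ltn_trans ji) // subzn ?leq_subr // subKn // eqz_nat ltz_nat b2 andbT.
  by rewrite eqn_leq -ltnS b1 (leq_trans (part_anti mu ji)) //; have [] := il j.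
(* Row i loses boxes, so mu_(i+1) <= nu_i < mu_i and i is the last row of its length. *)
have -> : (count (fun j => nth 0 (plist n mu) j == nth 0 (plist n mu) i) (iota 0 i)).+1 =
    mult (nth 0%N mu i) mu.
  rewrite /mult (@count_part _ _ n) //; last by rewrite /=; lia.
  rewrite (@big_cat_nat _ _ _ i.+1) //= big_nat_recr //= eqxx addn1.
  rewrite [X in (_ + X)%N]big1_seq ?addn0.
    rewrite -sum1_count big_mkcond /index_iota subn0 big_seq [in RHS]big_seq; congr _.+1.
    apply: eq_bigr => j; rewrite mem_iota => /andP[_ ji].
    by rewrite !nm // ?(ltn_trans ji) // eqz_nat; case: eqP.
  move=> j; rewrite mem_index_iota => /andP[_ /andP[ij jn]].
  have := part_anti mu ij; have := il i; case: eqP => //; lia.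
by case: hasbox; rewrite /= ?subr0.
Qed.

Lemma strip_weight_psi_prod n nu lam : interlace nu lam -> (size nu <= n)%N -> (size lam <= n.+1)%N ->
  strip_weight t 0 (rev_plist n nu) (revdiff n nu lam) =
  \prod_(0 <= i < n.+1 | psi_cond nu lam n.+1 i) (1 - t ^+ mult (nth 0%N nu i) nu).
Proof.
move=> il nn ln; rewrite strip_weight_state ?size_mkseq // [RHS]big_mkcond big_nat_rev /= add0n.
apply: eq_big_nat => k /= kn; rewrite subSS (@stateE _ _ _ _ _ n.+1) //; last 2 first.
- move=> j jn; rewrite !nth_mkseq ?(ltnW jn) //.
  have E : ((n - j.+1).+1 = n - j)%N by lia.
  have [_] := il (n - j.+1)%N; have [] := il (n - j)%N; rewrite E; lia.
- lia.
have nm j : (j < n.+1)%N -> nth 0 (rev_plist n nu) j = - (nth 0%N nu (n - j))%:Z by move=> ?; rewrite nth_mkseq.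
have ne j : (j < n.+1)%N -> nth 0%N (revdiff n nu lam) j = (nth 0 lam (n - j) - nth 0 nu (n - j))%N.
  by move=> ?; rewrite nth_mkseq.
have nk : (n - k < n.+1)%N by lia.
have kk : (n - (n - k) = k)%N by lia.
rewrite ne // kk (nm 0%N) // (nm (n - k)%N) // kk subn0 (nth_default _ nn).
rewrite /psi_cond.
case: (posnP (nth 0 lam k - nth 0 nu k)%N) => [E|e0].
  by rewrite E (_ : (nth 0 nu k < nth 0 lam k)%N = false) ?andbF //; lia.
rewrite (_ : nth 0 nu k < nth 0 lam k)%N /=; last lia.
rewrite -(prednK e0) [LHS]/=.
(* The zero parts of nu form the first block, where the state stays 0. *)
case: (posnP (nth 0%N nu k)) => [-> /=|k0].
  by rewrite ?oppr0 ?eqxx mul0r if_same subr0.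
rewrite [X in if X then 0 * _ else _](_ : _ = false); last by apply/negbTE; lia.
(* A shorter row grows to length nu_k exactly when it owns the box in column nu_k. *)
have -> : has (fun j => (nth 0 (rev_plist n nu) j - (nth 0%N (revdiff n nu lam) j)%:Z == - (nth 0%N nu k)%:Z)
      && (- (nth 0%N nu k)%:Z < nth 0 (rev_plist n nu) j)) (iota 0 (n - k)) =
    hasbox nu lam n.+1 (nth 0 nu k).
  apply/hasP/(hasboxP _ _ ln) => [[j]|[j bj]].
    rewrite mem_iota /= add0n => ji; have [le _] := il (n - j)%N.
    have jn : (j < n.+1)%N by lia.
    rewrite nm ?ne // -opprD eqr_opp -PoszD subnKC // eqz_nat ltrN2 ltz_nat.
    by move=> /andP[/eqP E lt]; exists (n - j)%N; rewrite /box E lt leqnn.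
  move: bj; rewrite /box => /andP[b1 b2].
  have kj : (k < j)%N.
    by rewrite ltnNge; apply/negP => /(part_anti nu) ge; rewrite ltnNge ge in b1.
  have jn : (j < n.+1)%N.
    by rewrite ltnNge; apply/negP => nj; move: b2; rewrite [nth 0 lam j]nth_default ?(leq_trans ln) //; lia.
  exists (n - j)%N; first by rewrite mem_iota; lia.
  have [le _] := il j; have njn : (n - j < n.+1)%N by lia.
  rewrite nm ?ne // subKn // -opprD eqr_opp -PoszD subnKC // eqz_nat ltrN2 ltz_nat b1 andbT.
  rewrite eqn_leq b2 andbT; case: j kj {jn b1 b2 le njn} => // j kj.
  by rewrite (leq_trans _ (part_anti nu (kj : k <= j)%N)) //; have [] := il j.
have -> : (count (fun j => nth 0 (rev_plist n nu) j == - (nth 0%N nu k)%:Z) (iota 0 (n - k))).+1 =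
    mult (nth 0%N nu k) nu.
  rewrite /mult (@count_part _ _ n.+1) ?leqW //; last by rewrite /=; lia.
  rewrite (@big_cat_nat _ _ _ k.+1) //= big_nat_recr //= eqxx.
  rewrite [X in (X + _ + _)%N]big1_seq ?add0n ?add1n.
    rewrite -sum1_count big_mkcond big_nat_rev /=.
    rewrite -[in RHS](add0n k.+1) big_addn subSS /index_iota subn0 big_seq [in RHS]big_seq; congr _.+1.
    apply: eq_bigr => j; rewrite mem_iota => /andP[_ jk].
    rewrite nm; last lia.
    rewrite (_ : 0 + k.+1 + n.+1 - (j + k.+1).+1 = n - j)%N; last lia.
    by rewrite eqr_opp eqz_nat; case: eqP.
  move=> j; rewrite mem_index_iota => /andP[_ /andP[_ jk]].
  case: k jk e0 {kn nk kk k0} => // k jk e0.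
  have := part_anti nu (jk : j <= k)%N; have := il k; case: eqP => //; lia.
by case: hasbox; rewrite /= ?subr0.
Qed.
End Weights.

(** * The Pieri rule *)

Lemma size_sub_part n mu e : (size (sub_part n mu e) <= n)%N.
Proof.
rewrite /sub_part /mkpart /= size_filter; apply: leq_trans (count_size _ _) _.
by rewrite size_sort size_mkseq.
Qed.

Lemma plist_sorted n (mu : intpart) : sorted >=%R (plist n mu).
Proof.
apply/(sortedP 0) => i; rewrite size_mkseq => i_n.
rewrite !nth_mkseq ?(ltnW i_n) //= lez_nat; exact: part_anti.
Qed.

Lemma plist_ge0 n (mu : intpart) : all (fun z => 0 <= z) (plist n mu).
Proof. by apply/allP => _ /mapP[i _ ->]. Qed.

(** Subtracting [e] and then adding [e'] is a bijection onto the pairs of strips; entries are at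
    most a or b, so the bound [N] loses none. *)
Lemma sum_strips (M : nmodType) n N (mu : intpart) a b (F : intpart * intpart -> M) :
  (size mu <= n)%N -> (a < N)%N -> (b < N)%N ->
  \sum_(nl \in [set nl : intpart * intpart | hstrip a nl.1 mu /\ hstrip b nl.1 nl.2]) F nl =
  \sum_(e <- exponents N n | fits (plist n.+1 mu) e && (sumn e == a))
    \sum_(e' <- exponents N n.+1 | fits (rev_plist n (sub_part n mu e)) e' && (sumn e' == b))
      F (sub_part n mu e, add_part n (sub_part n mu e) e').
Proof.
move=> mn aN bN.
pose E := [seq e <- exponents N n | fits (plist n.+1 mu) e && (sumn e == a)].
pose E' e := [seq e' <- exponents N n.+1 | fits (rev_plist n (sub_part n mu e)) e' && (sumn e' == b)].
pose r := [seq (sub_part n mu e, add_part n (sub_part n mu e) e') | e <- E, e' <- E' e].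
have ur : uniq r.
  apply: allpairs_uniq_dep => [|e _|]; try by apply: filter_uniq; apply: exponents_uniq.
  move=> [e1 e1'] [e2 e2'] /allpairsPdep[x [x' [+ + [-> ->]]]] /allpairsPdep[y [y' [+ + [-> ->]]]].
  rewrite !mem_filter => /andP[/andP[xf _] xi] /andP[/andP[xf' _] xi'].
  move=> /andP[/andP[yf _] yi] /andP[/andP[yf' _] yi'] Ep.
  have En : sub_part n mu x = sub_part n mu y := congr1 fst Ep.
  have El := congr1 snd Ep; rewrite /= in El.
  have [_ _ xE _] := sub_partP mn xi xf; have [_ _ yE _] := sub_partP mn yi yf.
  have xy : x = y by rewrite -xE -yE En.
  rewrite xy in El xf' *.
  have [_ _ _ xE' _] := add_partP (size_sub_part n mu y) xi' xf'.
  have [_ _ _ yE' _] := add_partP (size_sub_part n mu y) yi' yf'.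
  by rewrite -xE' El yE'.
have rP nl : nl \in r <-> hstrip a nl.1 mu /\ hstrip b nl.1 nl.2.
  split=> [/allpairsPdep[e [e' [+ + ->]]]|[h1 h2]].
    rewrite !mem_filter => /andP[/andP[ef /eqP ea] ei] /andP[/andP[ef' /eqP eb] ei'] /=.
    have [il sE _ _] := sub_partP mn ei ef.
    have [il' sE' _ _ _] := add_partP (size_sub_part n mu e) ei' ef'.
    by split; apply/hstripP; rewrite -?ea -?eb.
  have [ei ef ea eE] := rowdiffP mn h1 aN.
  have nn : (size nl.1 <= n)%N by rewrite -eE size_sub_part.
  have [ei' ef' eb eE'] := revdiffP nn h2 bN.
  apply/allpairsPdep; exists (rowdiff n mu nl.1), (revdiff n nl.1 nl.2).
  rewrite !mem_filter ei ef ea ei' eE ef' eb !eqxx /= eE' -surjective_pairing; split=> //.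
have -> : [set nl : intpart * intpart | hstrip a nl.1 mu /\ hstrip b nl.1 nl.2] = [set` r].
  by apply/seteqP; split=> nl /= /rP.
rewrite -fsbig_seq // /r big_allpairs_dep /= big_filter.
by apply: eq_bigr => e _; rewrite big_filter.
Qed.

Lemma sum_total_degree (M : nmodType) r N n P (H : seq nat -> nat -> M) :
  \sum_(ab : 'I_r.+1 * 'I_r.+1 | (ab.1 + ab.2 == r)%N)
    \sum_(e <- exponents N n | P e && (sumn e == ab.1)) H e ab.2 =
  \sum_(e <- exponents N n | P e && (sumn e <= r)%N) H e (r - sumn e)%N.
Proof.
rewrite (exchange_big_dep (fun e => P e && (sumn e <= r)%N)) /=; last first.
  by move=> ab e _ /andP[-> /eqP ->]; rewrite -ltnS ltn_ord.
apply: eq_bigr => e /andP[Pe er].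
pose ab0 : 'I_r.+1 * 'I_r.+1 := (inord (sumn e), inord (r - sumn e)).
have a0 : nat_of_ord ab0.1 = sumn e by rewrite inordK.
have b0 : nat_of_ord ab0.2 = (r - sumn e)%N by rewrite inordK // ltnS leq_subr.
rewrite (big_pred1 ab0) ?b0 // => -[x y] /=.
rewrite Pe /= xpair_eqE -!val_eqE /= in a0 b0 *.
rewrite a0 b0; lia.
Qed.

Section Pieri.
Variables (K : comNzRingType) (M : comAlgType K) (tq theta : K) (rc : nat -> K).
Variable v : int -> M.
Hypothesis rc0 : rc 0 = 1.
Hypothesis rc1 : rc 1 - tq = - 1.
Hypothesis rcS : forall s, rc s.+2 = tq * rc s.+1.
Hypothesis rc_conv : forall d,
  \sum_(0 <= i < d.+1) rc i * strip_coef tq (d - i) = (d == 0%N)%:R.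
Hypothesis v_neg : forall k : int, k < 0 -> v k = 0.
Hypothesis torsion2 : forall z : M, z + z = 0 -> z = 0.

Lemma pieri_lists n (mu : intpart) r N : (size mu <= n)%N ->
  wsum n.+1 (embed (rcons (plist n mu) r%:Z)) < N%:Z -> (r < N)%N ->
  Vn tq theta rc v n (embed (plist n mu)) * v r%:Z =
  \sum_(e <- exponents N n | fits (plist n.+1 mu) e && (sumn e <= r)%N)
    \sum_(e' <- exponents N n.+1 |
        fits (rev_plist n (sub_part n mu e)) e' && (sumn e' == r - sumn e)%N)
      (theta ^+ sumn e * (strip_weight tq tq (plist n mu) e * strip_weight tq 0 (rev_plist n (sub_part n mu e)) e')) *:
        Vn tq theta rc v n.+1 (embed (plist n.+1 (add_part n (sub_part n mu e) e'))).
Proof.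
move=> mn muN rN.
rewrite (Vn_Wn theta rc0 rc1 rcS rc_conv v_neg torsion2 (size_mkseq _ n) (plist_sorted n mu) muN rN).
rewrite rcons_plist // big_seq_cond [RHS]big_seq_cond.
apply: eq_bigr => e /andP[ei /andP[ef er]].
have [il _ _ lE] := sub_partP mn ei ef.
set nu := sub_part n mu e in il lE *; have nn : (size nu <= n)%N := size_sub_part n mu e.
rewrite lE (Wn_Vn_sum theta rc0 rc1 rcS rc_conv v_neg torsion2 (size_mkseq _ n) (plist_sorted n nu) (plist_ge0 n nu) (N := N)).
- rewrite negrev_plist // scaler_sumr big_seq_cond [RHS]big_seq_cond.
  apply: eq_bigr => e' /andP[ei' /andP[ef' _]].
  have [_ _ _ _ ->] := add_partP nn ei' ef'.
  by rewrite scalerA; congr (_ *: _); ring.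
- apply: le_lt_trans muN; apply: wsum_le => i.
  rewrite /embed !nth_rcons !size_mkseq; case: ltngtP => i_n //; last by rewrite lez_nat leq_subr.
  by rewrite !nth_mkseq // lez_nat; have [] := il i.
- by apply: leq_ltn_trans rN; apply: leq_subr.
Qed.

Lemma pieri_partitions (ph ps : intpart -> intpart -> K) (Vp : intpart -> M) (r : nat) (mu : intpart) :
  (forall n mu nu, interlace nu mu -> (size mu <= n)%N ->
     strip_weight tq tq (plist n mu) (rowdiff n mu nu) = ph mu nu) ->
  (forall n nu lam, interlace nu lam -> (size nu <= n)%N -> (size lam <= n.+1)%N ->
     strip_weight tq 0 (rev_plist n nu) (revdiff n nu lam) = ps lam nu) ->
  (forall n (lam : intpart), (size lam <= n)%N ->
     Vp lam = Vn tq theta rc v n (embed (plist n lam))) ->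
  Vp mu * v r =
  \sum_(ab : 'I_r.+1 * 'I_r.+1 | (ab.1 + ab.2 == r)%N)
    \sum_(nl \in [set nl : intpart * intpart |
                    hstrip ab.1 nl.1 mu /\ hstrip ab.2 nl.1 nl.2])
      (theta ^+ ab.1 * (ph mu nl.1 * ps nl.2 nl.1)) *: Vp nl.2.
Proof.
move=> strip_weight_phi strip_weight_psi Vi_Vn.
pose n := size mu; have mn : (size mu <= n)%N by [].
pose N := (`|wsum n.+1 (embed (rcons (plist n mu) r%:Z))| + r).+1.
rewrite (Vi_Vn n) // (pieri_lists (N := N) mn); last first.
- by rewrite /N; lia.
- by rewrite /N; lia.
pose T e e' : M := (theta ^+ sumn e *
   (strip_weight tq tq (plist n mu) e * strip_weight tq 0 (rev_plist n (sub_part n mu e)) e')) *: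
   Vn tq theta rc v n.+1 (embed (plist n.+1 (add_part n (sub_part n mu e) e'))).
transitivity (\sum_(ab : 'I_r.+1 * 'I_r.+1 | (ab.1 + ab.2 == r)%N)
  \sum_(e <- exponents N n | fits (plist n.+1 mu) e && (sumn e == ab.1))
    \sum_(e' <- exponents N n.+1 |
        fits (rev_plist n (sub_part n mu e)) e' && (sumn e' == ab.2)) T e e').
  by rewrite (@sum_total_degree _ r N n (fits (plist n.+1 mu))
    (fun e b => \sum_(e' <- exponents N n.+1 |
        fits (rev_plist n (sub_part n mu e)) e' && (sumn e' == b)) T e e')).
apply: eq_bigr => -[a b] _ /=.
have ltN (c : 'I_r.+1) : (c < N)%N by have := ltn_ord c; rewrite /N; lia.
rewrite (@sum_strips _ n N mu a b (fun nl => (theta ^+ a * (ph mu nl.1 * ps nl.2 nl.1))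
  *: Vp nl.2) mn (ltN a) (ltN b)).
rewrite big_seq_cond [RHS]big_seq_cond; apply: eq_bigr => e /andP[ei /andP[ef /eqP ea]].
have [il _ eE _] := sub_partP mn ei ef.
have nn := size_sub_part n mu e.
rewrite big_seq_cond [RHS]big_seq_cond; apply: eq_bigr => e' /andP[ei' /andP[ef' _]].
have [il' _ ln e'E _] := add_partP nn ei' ef'.
rewrite [fst _]/= [snd _]/= (Vi_Vn n.+1 _ ln) /T -ea -(strip_weight_phi _ _ _ il mn) -(strip_weight_psi _ _ _ il' nn ln).
by rewrite eE e'E.
Qed.
End Pieri.

(** * Specialization to the ground ring Q(t)[theta] *)

Lemma prod_polyC (phi : {rmorphism Qt -> Qtth}) n (P : pred nat) (m : nat -> nat) :
  phi (\prod_(0 <= i < n | P i) (1 - t ^+ m i)) = \prod_(0 <= i < n | P i) (1 - phi t ^+ m i).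
Proof. by rewrite rmorph_prod; apply: eq_bigr => i _; rewrite rmorphB rmorph1 rmorphXn. Qed.

Definition rc s : Qtth := (ratio_coef s)%:P.

Definition tq : Qtth := t%:P.

Lemma t_neq0 : t != 0.
Proof. by rewrite /t tofrac_eq0 polyX_eq0. Qed.

Lemma rc_conv d :
  \sum_(0 <= i < d.+1) rc i * strip_coef tq (d - i) = (d == 0%N)%:R.
Proof. by apply: (strip_coef_inverse polyC); [exact: t_neq0 | |]. Qed.

Lemma rc0 : rc 0 = 1.
Proof. by rewrite /rc polyC1. Qed.

Lemma rc1 : rc 1 - tq = - 1.
Proof.
rewrite /rc /tq -polyCB (_ : ratio_coef 1 - t = - 1) ?polyCN //.
by rewrite /ratio_coef expr1 mulrBl mulVf ?t_neq0 // mul1r addrC addKr.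
Qed.

Lemma rcS s : rc s.+2 = tq * rc s.+1.
Proof. by rewrite /rc /tq -polyCM; congr polyC; rewrite /ratio_coef [t ^+ s.+2]exprS mulrCA. Qed.

Lemma v_neg (k : int) : k < 0 -> v k = 0.
Proof. by case: k. Qed.

(** 2 is invertible in Q(t). *)
Lemma Lam_torsion2 (z : Lam) : z + z = 0 -> z = 0.
Proof.
move=> z0; have c2 : (2%:R : Qt) != 0.
  have -> : (2%:R : Qt) = tofrac (2%:R : {poly rat}) by rewrite tofracMn tofrac1.
  by rewrite tofrac_eq0 -polyC_natr polyC_eq0.
have : ((2%:R : Qt)^-1)%:P *: (z + z) = 0 :> Lam by rewrite z0 scaler0.
rewrite -mulr2n -scaler_nat scalerA.
by rewrite -polyC_natr -polyCM mulVf // scale1r.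
Qed.

Lemma intvec_of_partitionE lam i : intvec_of_partition lam i = (nth 0%N lam i)%:Z.
Proof.
rewrite /intvec_of_partition fsfun_fun in_fset /= mem_iota /= add0n.
by case: ltnP => // il; rewrite nth_default.
Qed.

(** Zero rows at the end are allowed, so mu on n rows and lambda on n + 1 rows are both covered,
    whether or not the new row is empty. *)
Lemma Vi_Vn n (lam : intpart) : (size lam <= n)%N ->
  Vi (intvec_of_partition lam) = Vn tq theta rc v n (embed (plist n lam)).
Proof.
move=> ln; rewrite -[LHS]/(\sum_(lm \in [set lm | incexps lm])
  term theta rc v (intvec_of_partition lam) lm).
have an i : (n <= i)%N -> intvec_of_partition lam i = 0.
  by move=> ni; rewrite intvec_of_partitionE nth_default // (leq_trans ln).
have -> : embed (plist n lam) = intvec_of_partition lam.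
  apply: funext => i; rewrite intvec_of_partitionE /embed /plist.
  case: (ltnP i n) => i_n; first by rewrite nth_mkseq.
  by rewrite nth_default ?size_mkseq // nth_default // (leq_trans ln).
pose N := `|wsum n (intvec_of_partition lam)|.+1.
apply: (@sum_term _ _ tq theta rc v rc0 erefl v_neg n N _ an) => //; rewrite /N; lia.
Qed.

Lemma strip_weight_phi n mu nu : interlace nu mu -> (size mu <= n)%N ->
  strip_weight tq tq (plist n mu) (rowdiff n mu nu) = (phi mu nu)%:P.
Proof. by move=> il mn; rewrite strip_weight_phi_prod // (phiE il mn) prod_polyC. Qed.

Lemma strip_weight_psi n nu lam : interlace nu lam -> (size nu <= n)%N -> (size lam <= n.+1)%N ->
  strip_weight tq 0 (rev_plist n nu) (revdiff n nu lam) = (psi lam nu)%:P.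
Proof. by move=> il nn ln; rewrite strip_weight_psi_prod // (psiE il ln) prod_polyC. Qed.

Theorem theoremA (r : nat) (mu : intpart) (hr : (1 <= r)%N) :
  Vi (intvec_of_partition mu) * v r =
  \sum_(ab : 'I_r.+1 * 'I_r.+1 | (ab.1 + ab.2 == r)%N)
    \sum_(nl \in [set nl : intpart * intpart |
                    hstrip ab.1 nl.1 mu /\ hstrip ab.2 nl.1 nl.2])
      (theta ^+ ab.1 * (phi mu nl.1 * psi nl.2 nl.1)%:P)
        *: Vi (intvec_of_partition nl.2).
Proof.
rewrite (pieri_partitions rc0 rc1 rcS rc_conv v_neg Lam_torsion2 r mu strip_weight_phi strip_weight_psi Vi_Vn).
apply: eq_bigr => ab _; apply: eq_fsbigr => nl _.
by rewrite polyCM.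
Qed.
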